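(* Let $\rho>1$ be a prescribed constant, and let $\hat h^\delta$ be noisy data of $\hat h=Kg$ satisfying $\|\hat h^\delta-\hat h\|\le\delta$ and $0<\rho\delta<\|\hat h^\delta\|$. Let $g_{\tau,r}^\delta$ be the exponential-type Tikhonov regularized solution, where $\tau>0$ is chosen by the Morozov discrepancy principle $\|Kg_{\tau,r}^\delta-\hat h^\delta\|=\rho\delta$. (i) If $r\le0$ and there exists a constant $C_5>0$ such that $\|g\|_{D((-L)^p)}\le C_5$, $p>0$, then $$\|g_{\tau,r}^{\delta}-g\|\le\begin{cases} C\left[\left(\frac{C_5}{\rho-1}\right)^{\frac12}+C_5^{\frac1{p+1}}(1+\rho)^{\frac{p}{p+1}}\right]\delta^{\frac12}, & p\ge1,\\ C\left[\left(\frac{C_5}{\rho-1}\right)^{\frac1{p+1}}+C_5^{\frac1{p+1}}(1+\rho)^{\frac{p}{p+1}}\right]\delta^{\frac{p}{p+1}}, & 0<p<1.\end{cases}$$ (ii) If $r>0$ and there exists a constant $C_6>0$ such that $\|g\|_{r,\mathrm{exp}}\le C_6$, then, for any $p>0$, $$\|g_{\tau,r}^{\delta}-g\|\le C(2C_6)^{\frac{2}{p+2}}(1+\rho)^{\frac{p}{p+2}}\delta^{\frac{p}{p+2}}.$$ Here $C>0$ is independent of $\delta$, $\tau$ and $g$, but may depend on $p,r$ (and on the quantities fixed in the setting).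
   Context: Fix $\alpha\in(0,1]$, $\beta\ge 0$, $l>0$, $\rho>1$, and a bounded connected domain $\Omega\subset\mathbb{R}^N$ ($N\ge1$) with smooth boundary. $(\cdot,\cdot)$ and $\|\cdot\|$ are the inner product and norm of $L^2(\Omega)$. $-L:H^2(\Omega)\cap H_0^1(\Omega)\to L^2(\Omega)$ is a fixed symmetric uniformly elliptic operator with eigenpairs $-L\varphi_k=\lambda_k\varphi_k$, $0<\lambda_1\le\lambda_2\le\cdots\to\infty$, where $\{\varphi_k\}_{k\ge1}$ is a complete orthonormal basis of $L^2(\Omega)$. $\|\psi\|_{D((-L)^s)}=(\sum_k\lambda_k^{2s}|(\psi,\varphi_k)|^2)^{1/2}$ and $\|\psi\|_{r,\mathrm{exp}}=(\sum_k\exp(\lambda_k^r)|(\psi,\varphi_k)|^2)^{1/2}$; a bound on one of these norms includes the assertion that it is finite. Kilbas–Saigo function: $E_{\alpha,m,n}(z)=1+\sum_{k=1}^\infty\prod_{j=0}^{k-1}\frac{\Gamma(\alpha(jm+n)+1)}{\Gamma(\alpha(jm+n+1)+1)}z^k$ ($\alpha,m>0$, $n>-1/\alpha$). Put $\eta_2=\frac{\Gamma(1+\beta)}{\Gamma(1+\alpha+\beta)}$ and $$\sigma_k=\frac{\eta_2}{\sqrt{\lambda_k}}\,l^{\alpha+\beta}E_{\alpha,1+\frac{\beta}{\alpha},1+\frac{2\beta}{\alpha}}\left(-\sqrt{\lambda_k}\,l^{\alpha+\beta}\right),\qquad Kg=\sum_{k=1}^\infty\sigma_k(g,\varphi_k)\varphi_k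 .$$ $g\in L^2(\Omega)$ is the exact source term, $\hat h=Kg$ the exact data, and $\hat h^\delta\in L^2(\Omega)$ the noisy data with noise level $\delta>0$. For $\tau>0$, $r\in\mathbb{R}$ the exponential-type Tikhonov regularized solution (the minimizer of $\|Kv-\hat h^\delta\|^2+\tau\|v\|_{r,\mathrm{exp}}^2$ over $v$) is $$g_{\tau,r}^\delta=\sum_{k=1}^\infty\frac{\sigma_k}{\sigma_k^2+\tau\exp(\lambda_k^r)}(\hat h^\delta,\varphi_k)\varphi_k .$$ *)

(* Defs.v *)
From HB Require Import structures.
From mathcomp Require Import all_boot all_order all_algebra.
From mathcomp Require Import all_classical all_reals all_analysis.
From mathcomp Require Import measurable_realfun.

Set Implicit Arguments.
Unset Strict Implicit.
Unset Printing Implicit Defensive.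

Import Order.TTheory GRing.Theory Num.Theory.
Import numFieldNormedType.Exports.

Local Open Scope classical_set_scope.
Local Open Scope ring_scope.

Definition borelRV (R : realType) (N : nat) :=
  g_sigma_algebraType (@open 'rV[R]_N).

Section borelRV.
Context {R : realType}.

Lemma borelRV_open N (U : set 'rV[R]_N) : open U -> @measurable _ (borelRV R N) U.
Proof. exact: sub_sigma_algebra. Qed.

Lemma borelRV_coord N (i : 'I_N) :
  measurable_fun setT (fun v : borelRV R N => (v : 'rV[R]_N) ord0 i).
Proof.
apply: (measurability _ (RGenOpens.measurableE R)) => // _ [_ [a [b ->]] <-].
rewrite setTI; apply: borelRV_open.
have /continuousP : continuous (fun v : 'rV[R]_N => v ord0 i).
  exact: coord_continuous.
by apply; exact: interval_open.
Qed.

Lemma open_rat_balls N (U : set 'rV[R]_N) : open U ->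
  U = \bigcup_(s in [set s : 'rV[rat]_N * nat |
         ball (map_mx (@ratr R) s.1) s.2.+1%:R^-1 `<=` U])
       ball (map_mx (@ratr R) s.1) s.2.+1%:R^-1.
Proof.
move=> oU; apply/seteqP; split=> [x Ux|x [s sU]]; last exact: sU.
have /nbhs_ballP[e /= e0 xeU] := open_nbhs_nbhs (conj oU Ux).
have [k ke] : exists k : nat, 2 * k.+1%:R^-1 < e.
  have e20 : 0 < e / 2 by rewrite divr_gt0.
  exists (Num.truncn (e / 2)^-1).
  rewrite mulrC -ltr_pdivlMr// -[ltRHS]invrK ltf_pV2 ?posrE ?invr_gt0//.
  by apply: truncnS_gt.
set d := k.+1%:R^-1 in ke.
have d0 : 0 < d by rewrite invr_gt0.
have Hq (i : 'I_N) : exists q : rat, `|x ord0 i - ratr q| < d.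
  have : x ord0 i - d < x ord0 i + d by rewrite ltrD2l gt0_cp.
  move=> /rat_in_itvoo[q]; rewrite in_itv/= => /andP[q1 q2].
  by exists q; rewrite ltr_distlC; apply/andP; split.
pose q : 'rV[rat]_N := \row_i xchoose (Hq i).
have xq : ball (map_mx (@ratr R) q) d x.
  split=> // i j; rewrite (ord1 i) !mxE /ball/= distrC.
  exact: xchooseP (Hq j).
exists (q, k) => //= y qy; apply: xeU.
apply: (@le_ball _ _ _ (d + d)); first by rewrite -mulr2n -mulr_natl ltW.
by apply: (@ball_triangle _ _ (map_mx (@ratr R) q)) => //; exact: ball_sym.
Qed.

Lemma measurable_fun_rV d (T : measurableType d) N (f : T -> 'rV[R]_N) :
  (forall i, measurable_fun setT (fun t => f t ord0 i)) ->
  measurable_fun setT (f : T -> borelRV R N).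
Proof.
move=> mf.
apply: (@measurability _ _ T (borelRV R N) setT f (@open 'rV[R]_N)) => //.
move=> _ [U oU <-]; rewrite setTI (open_rat_balls oU) preimage_bigcup.
rewrite bigcup_mkcond; apply: countable_bigcupT_measurable => // -[q k].
case: ifP => // _ /=; set d0 := _^-1.
have d0_gt0 : 0 < d0 by rewrite invr_gt0.
rewrite (_ : _ @^-1` _ = \bigcap_(i in [set: 'I_N])
    ((fun t => f t ord0 i) @^-1` ball (ratr (q ord0 i) : R) d0)).
  apply: fin_bigcap_measurable => // i _; rewrite -[X in measurable X]setTI.
  by apply: mf => //; exact: measurable_ball.
apply/seteqP; split=> [t [_ bt] i _|t bt] /=.
  by have := bt ord0 i; rewrite mxE.
by split=> // i j; rewrite (ord1 i) mxE; exact: bt.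
Qed.

End borelRV.

Section lebesgueRV.
Context {R : realType}.

Definition consRV N (x : R) (v : 'rV[R]_N) : 'rV[R]_N.+1 :=
  \row_i oapp (v ord0) x (unlift ord0 i).

Lemma consRV0 N x (v : 'rV[R]_N) : consRV x v ord0 ord0 = x.
Proof.
by rewrite mxE unlift_none.
Qed.

Lemma consRVS N x (v : 'rV[R]_N) i : consRV x v ord0 (lift ord0 i) = v ord0 i.
Proof.
by rewrite mxE liftK.
Qed.

(* Lebesgue measure on R^N, by iterated integration of slices; it gives boxes
   their volume by [lebesgueRV_boxRV] below. *)
Fixpoint lebesgueRV N : set (borelRV R N) -> \bar R :=
  match N with
  | 0 => dirac ((0 : 'rV[R]_0) : borelRV R 0)
  | N'.+1 => fun A =>
      (\int[lebesgue_measure]_x lebesgueRV [set v : 'rV[R]_N' | A (consRV x v)])%E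
  end.

Definition boxRV N (a b : 'rV[R]_N) : set 'rV[R]_N :=
  [set v | forall i, a ord0 i <= v ord0 i <= b ord0 i].

Lemma measurable_boxRV N (a b : 'rV[R]_N) :
  measurable (boxRV a b : set (borelRV R N)).
Proof.
rewrite (_ : boxRV a b = \bigcap_(i in [set: 'I_N])
    ((fun v : borelRV R N => (v : 'rV[R]_N) ord0 i) @^-1`
      `[a ord0 i, b ord0 i]%classic)).
  apply: fin_bigcap_measurable => // i _; rewrite -[X in measurable X]setTI.
  by apply: borelRV_coord => //; exact: measurable_itv.
apply/seteqP; split=> [v bv i _|v bv i] /=; first by rewrite in_itv; exact: bv.
by have := bv i I; rewrite /= in_itv.
Qed.

Lemma measurable_consRV N : measurable_fun [set: measurableTypeR R * borelRV R N]
  (fun p => consRV p.1 p.2 : borelRV R N.+1).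
Proof.
apply: measurable_fun_rV => i; have [j ->|->] := unliftP ord0 i.
  under eq_fun do rewrite consRVS.
  by apply: (measurableT_comp (borelRV_coord j)); exact: measurable_snd.
under eq_fun do rewrite consRV0.
exact: measurable_fst.
Qed.

Lemma lebesgueRV_subproof N :
  exists m : {sigma_finite_measure set (borelRV R N) -> \bar R},
    (m : set _ -> _) = @lebesgueRV N /\
    forall a b : 'rV[R]_N, (forall i, a ord0 i <= b ord0 i) ->
      m (boxRV a b) = (\prod_(i < N) (b ord0 i - a ord0 i))%:E.
Proof.
elim: N => [|N [m [mE mbox]]].
  exists (dirac ((0 : 'rV[R]_0) : borelRV R 0) : {sigma_finite_measure set _ -> \bar R}).
  split=> // a b _; rewrite big_ord0 /= diracE mem_set// => -[] //.
pose c (p : measurableTypeR R * borelRV R N) : borelRV R N.+1 := consRV p.1 p.2.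
have mc : measurable_fun setT c := @measurable_consRV N.
pose mu : {measure set (borelRV R N.+1) -> \bar R} :=
  measure_function_pushforward__canonical__measure_function_Measure
    (lebesgue_measure \x m)%E mc.
have muE : (mu : set _ -> _) = @lebesgueRV N.+1.
  apply/funext => A /=; rewrite /pushforward /product_measure1.
  apply: eq_integral => x _; rewrite /= -mE; congr (m _).
  by apply/seteqP; split=> v; rewrite /xsection /= inE.
have mubox (a b : 'rV[R]_N.+1) : (forall i, a ord0 i <= b ord0 i) ->
    mu (boxRV a b) = (\prod_(i < N.+1) (b ord0 i - a ord0 i))%:E.
  move=> ab; pose tl (v : 'rV[R]_N.+1) : 'rV[R]_N := \row_i v ord0 (lift ord0 i).
  rewrite /mu /= /pushforward.
  rewrite (_ : c @^-1` _ =
      `[a ord0 ord0, b ord0 ord0]%classic `*` boxRV (tl a) (tl b)).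
    rewrite product_measure1E//; last exact: measurable_boxRV.
    rewrite mbox => [|i]; last by rewrite !mxE.
    rewrite big_ord_recl EFinM; congr (_ * _)%E; last first.
      by congr EFin; apply: eq_bigr => i _; rewrite !mxE.
    apply: etrans (lebesgue_measure_itv `[a ord0 ord0, b ord0 ord0]) _.
    rewrite /= lte_fin; case: ltgtP (ab ord0) => // -> _; by rewrite subrr.
  apply/seteqP; split=> [[x v]/= h|[x v]/= [hx hv] i].
    split; first by have := h ord0; rewrite consRV0 in_itv.
    by move=> i; have := h (lift ord0 i); rewrite consRVS !mxE.
  have [j ->|->] := unliftP ord0 i; first by rewrite consRVS; have := hv j; rewrite !mxE.
  by rewrite consRV0; move: hx; rewrite in_itv.
have muS : sigma_finite [set: borelRV R N.+1] mu.
  exists (fun k : nat => boxRV (const_mx (- k%:R)) (const_mx k%:R)).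
    apply/seteqP; split=> // v _.
    exists (Num.truncn `|v : 'rV[R]_N.+1|).+1 => // i; rewrite !mxE -ler_norml.
    apply: le_trans (ltW (truncnS_gt _)).
    rewrite [leRHS]/Num.norm /= mx_normrE; apply/bigmax_geP; right => /=.
    by exists (ord0, i).
  move=> k; split; first exact: measurable_boxRV.
  by rewrite mubox ?ltry// => i; rewrite !mxE ge0_cp//.
pose muP := Measure_isSigmaFinite.Build _ _ _ (mu : set _ -> _) muS.
exists (HB.pack_for (SigmaFiniteMeasure.type (borelRV R N.+1) R)
  (Measure.sort mu) muP).
by split.
Qed.

Section lebesgueRV_measure.
Variable N : nat.

Let lebesgueRV_set0 : @lebesgueRV N set0 = 0%E.
Proof. by have [m [<- _]] := lebesgueRV_subproof N; rewrite measure0. Qed.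

Let lebesgueRV_ge0 A : (0 <= @lebesgueRV N A)%E.
Proof. by have [m [<- _]] := lebesgueRV_subproof N; exact: measure_ge0. Qed.

Let lebesgueRV_sigma_additive : semi_sigma_additive (@lebesgueRV N).
Proof.
by have [m [<- _]] := lebesgueRV_subproof N; exact: measure_semi_sigma_additive.
Qed.

HB.instance Definition _ := isMeasure.Build _ _ _ (@lebesgueRV N)
  lebesgueRV_set0 lebesgueRV_ge0 lebesgueRV_sigma_additive.

Let lebesgueRV_sigma_finite : sigma_finite setT (@lebesgueRV N).
Proof. by have [m [<- _]] := lebesgueRV_subproof N; exact: sigma_finiteT. Qed.

HB.instance Definition _ := Measure_isSigmaFinite.Build _ _ _ (@lebesgueRV N)
  lebesgueRV_sigma_finite.

Lemma lebesgueRV_boxRV (a b : 'rV[R]_N) : (forall i, a ord0 i <= b ord0 i) ->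
  lebesgueRV (boxRV a b) = (\prod_(i < N) (b ord0 i - a ord0 i))%:E.
Proof. by have [m [<- mbox]] := lebesgueRV_subproof N; exact: mbox. Qed.

End lebesgueRV_measure.
End lebesgueRV.

Section domain.
Context {R : realType} {N : nat}.
Implicit Types (U Omega : set 'rV[R]_N) (f u v psi : 'rV[R]_N -> R).

Definition partial (i : 'I_N) f : 'rV[R]_N -> R := 'D_(delta_mx ord0 i) f.

(* Used for open [U] only. *)
Fixpoint Ck_on U (k : nat) f : Prop :=
  (forall x, U x -> {for x, continuous f}) /\
  match k with
  | 0 => True
  | k'.+1 => forall i, (forall x, U x -> derivable f x (delta_mx ord0 i)) /\
                       Ck_on U k' (partial i f)
  end.

Definition smooth_on U f := forall k, Ck_on U k f.

(* [Omega] is open, so [closure Omega `\` Omega] is its boundary; around each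
   boundary point [Omega] is a strict sublevel set of a smooth function with
   nonvanishing gradient, hence lies locally on one side of a smooth
   hypersurface. *)
Definition smooth_boundary Omega :=
  forall x, (closure Omega `\` Omega) x ->
  exists U psi, [/\ open U, U x, smooth_on U psi,
    (exists i, partial i psi x != 0) &
    Omega `&` U = [set y | U y /\ psi y < 0] ].

Definition smooth_bounded_domain Omega :=
  [/\ open Omega, Omega !=set0, connected Omega, bounded_set Omega &
      smooth_boundary Omega].

Section L2.
Variable Omega : set 'rV[R]_N.

(* Elements of L^2(Omega) are represented by functions; only their a.e. class on
   [Omega] matters. *)
Definition inL2 f :=
  measurable_fun (Omega : set (borelRV R N)) (f : borelRV R N -> R) /\
  (@lebesgueRV R N).-integrable Omega (fun x : borelRV R N => ((f x) ^+ 2)%:E).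

Definition L2inner f g : R := \int[@lebesgueRV R N]_(x in Omega) (f x * g x).

Definition L2norm f : R := Num.sqrt (L2inner f f).

Definition L2cvg (f_ : nat -> 'rV[R]_N -> R) f :=
  L2norm (fun x => f_ n x - f x) @[n --> \oo] --> (0 : R).

Definition ae_eq_on f g := ae_eq (@lebesgueRV R N) Omega f g.

End L2.

Section Sobolev.
Variable Omega : set 'rV[R]_N.

Definition test_function psi :=
  smooth_on setT psi /\
  exists K, [/\ compact K, K `<=` Omega & forall x, ~ K x -> psi x = 0].

Definition weak_partial i u v :=
  forall psi, test_function psi ->
    L2inner Omega u (partial i psi) = - L2inner Omega v psi.

Definition weak_gradient u (du : 'I_N -> 'rV[R]_N -> R) :=
  inL2 Omega u /\ forall i, inL2 Omega (du i) /\ weak_partial i u (du i).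

Definition weak_hessian u (du : 'I_N -> 'rV[R]_N -> R)
    (ddu : 'I_N -> 'I_N -> 'rV[R]_N -> R) :=
  weak_gradient u du /\ forall i, weak_gradient (du i) (ddu i).

Definition inH2 u := exists du ddu, weak_hessian u du ddu.

Definition inH10 u :=
  exists2 du, weak_gradient u du &
  exists psi : nat -> 'rV[R]_N -> R,
    [/\ forall n, test_function (psi n), L2cvg Omega psi u &
        forall i, L2cvg Omega (fun n => partial i (psi n)) (du i)].

(* A second-order operator in nondivergence form with bounded measurable
   coefficients, symmetric on H^2 \cap H^1_0 as an operator of L^2(Omega). *)
Definition symmetric_uniformly_elliptic (L : ('rV[R]_N -> R) -> 'rV[R]_N -> R) :=
  exists (a : 'I_N -> 'I_N -> 'rV[R]_N -> R) (b : 'I_N -> 'rV[R]_N -> R)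
         (c : 'rV[R]_N -> R),
  [/\ (exists M : R, forall x, Omega x -> [/\ forall i j, `|a i j x| <= M,
         forall i, `|b i x| <= M & `|c x| <= M]),
      [/\ forall i j, measurable_fun (Omega : set (borelRV R N)) (a i j : borelRV R N -> R),
          forall i, measurable_fun (Omega : set (borelRV R N)) (b i : borelRV R N -> R) &
          measurable_fun (Omega : set (borelRV R N)) (c : borelRV R N -> R)],
      (exists2 theta : R, 0 < theta &
         forall x, Omega x -> (forall i j, a i j x = a j i x) /\
         forall xi : 'I_N -> R,
           theta * \sum_i xi i ^+ 2 <= \sum_i \sum_j a i j x * xi i * xi j),
      (forall u du ddu, inH10 u -> weak_hessian u du ddu ->
         inL2 Omega (L u) /\
         ae_eq_on Omega (L u) (fun x => \sum_i \sum_j a i j x * ddu i j x +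
                                \sum_i b i x * du i x + c x * u x)) &
      (forall u v, inH2 u -> inH10 u -> inH2 v -> inH10 v ->
         L2inner Omega (L u) v = L2inner Omega u (L v)) ].

End Sobolev.

Section eigenbasis.
Variables (Omega : set 'rV[R]_N) (phi : nat -> 'rV[R]_N -> R).

(* [f] is the sum of the series [\sum_k c_k phi_k], convergent in L^2(Omega);
   a relation, since the sum is only determined up to a.e. equality. *)
Definition L2sum (c : nat -> R) f :=
  inL2 Omega f /\ L2cvg Omega (fun n x => \sum_(0 <= k < n) c k * phi k x) f.

Definition complete_orthonormal_basis :=
  [/\ forall k, inL2 Omega (phi k),
      forall j k, L2inner Omega (phi j) (phi k) = (j == k)%:R &
      forall f, inL2 Omega f -> L2sum (fun k => L2inner Omega f (phi k)) f].

Variable lambda : nat -> R.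

(* Indices start at 0: [lambda k] and [phi k] are the (k+1)-st eigenpair. *)
Definition eigensystem (L : ('rV[R]_N -> R) -> 'rV[R]_N -> R) :=
  [/\ 0 < lambda 0,
      (forall k, lambda k <= lambda k.+1),
      lambda k @[k --> \oo] --> +oo,
      complete_orthonormal_basis &
      forall k, [/\ inH2 Omega (phi k), inH10 Omega (phi k) &
        ae_eq_on Omega (fun x => - L (phi k) x) (fun x => lambda k * phi k x)] ].

(* Both norms are valued in [\bar R] and equal to [+oo] when the series diverges,
   so that a real bound on them includes finiteness. *)
Definition Dnorm (s : R) psi : \bar R :=
  ((\sum_(0 <= k <oo) (lambda k `^ (2 * s) * L2inner Omega psi (phi k) ^+ 2)%:E)
     `^ 2^-1)%E.

Definition expnorm (r : R) psi : \bar R :=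
  ((\sum_(0 <= k <oo) (expR (lambda k `^ r) * L2inner Omega psi (phi k) ^+ 2)%:E)
     `^ 2^-1)%E.

End eigenbasis.
End domain.

Section KilbasSaigo.
Context {R : realType}.

Definition Gamma (x : R) : R :=
  \int[lebesgue_measure]_(t in `]0, +oo[) (t `^ (x - 1) * expR (- t)).

Definition KilbasSaigo (alpha m n z : R) : R :=
  1 + limn (fun K : nat => \sum_(1 <= k < K)
    (\prod_(0 <= j < k) (Gamma (alpha * (j%:R * m + n) + 1) /
                         Gamma (alpha * (j%:R * m + n + 1) + 1))) * z ^+ k).

End KilbasSaigo.

Section regularization.
Context {R : realType} {N : nat}.
Variables (alpha beta l : R) (Omega : set 'rV[R]_N).
Variables (lambda : nat -> R) (phi : nat -> 'rV[R]_N -> R).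

Definition eta2 : R := Gamma (1 + beta) / Gamma (1 + alpha + beta).

Definition sigma (k : nat) : R :=
  eta2 / Num.sqrt (lambda k) * l `^ (alpha + beta) *
  KilbasSaigo alpha (1 + beta / alpha) (1 + 2 * beta / alpha)
    (- (Num.sqrt (lambda k) * l `^ (alpha + beta))).

(* [Kop g h] says that [h] is (a representative of) [K g]. *)
Definition Kop (g h : 'rV[R]_N -> R) :=
  L2sum Omega phi (fun k => sigma k * L2inner Omega g (phi k)) h.

Definition regularized_solution (tau r : R) (hd gt : 'rV[R]_N -> R) :=
  L2sum Omega phi (fun k =>
    sigma k / (sigma k ^+ 2 + tau * expR (lambda k `^ r)) *
    L2inner Omega hd (phi k)) gt.

End regularization.

(* Main.v *)
Require Import Defs.
From mathcomp Require Import all_boot all_order all_algebra.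
From mathcomp Require Import all_classical all_reals all_analysis.
From mathcomp Require Import measurable_realfun ring lra.

Import Order.TTheory GRing.Theory Num.Theory.
Import numFieldNormedType.Exports.

Local Open Scope classical_set_scope.
Local Open Scope ring_scope.

(* Let [gamma = alpha + beta] and [w t = E_(alpha, 1 + beta/alpha, beta/alpha)(- t ^ gamma)].
   An index shift in the Kilbas-Saigo series gives [sigma_k = (1 - w t_k) / lambda_k]
   with [t_k ^ gamma = sqrt lambda_k * l ^ gamma].  By the Beta integral, [w] solves
   [w t = 1 - Gamma(alpha)^-1 int_0^t (t - s)^(alpha - 1) s^beta w(s) ds].  A
   comparison of this equation at two times shows that [w] stays positive, hence
   [w <= 1], and its modulus of continuity then bounds [1 - w] away from 0 on
   every [[t1, +oo[ ].  Consequently [c / lambda_k <= sigma_k <= 1 / lambda_k].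

   By Parseval the rest is a computation on coefficients.  With
   [theta = tau e / (sigma^2 + tau e)], the error of the regularized solution is a
   noise term of norm at most [delta / sqrt tau] plus the bias [- theta g].  The
   discrepancy principle gives [(rho - 1) delta <= ||theta sigma g||], which bounds
   [tau] from below, and [||sigma theta g|| <= (1 + rho) delta], from which the bias
   is estimated by interpolation with the source condition.  When [r > 0], the
   minimizing property bounds the exponential norm of the regularized solution
   by that of [g], and one interpolates the error directly. *)

(** * Gamma and Beta integrals *)

(** The series of [w] alternates, so neither its sign nor its size for large [t] can be read off
    term by term; the integral equation supplies both. The gap of [1 - w] has to be uniform in [t]
    because one constant [c] must serve all eigenvalues; it depends on the spectrum only through
    [lambda 0]. The lower bound on [tau] rests on [theta sigma g] being of order tau^((1 + q)/2)
    under a source condition of order [q], which is available for [q <= 1] only. This saturation of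
    Tikhonov regularization stops the rate at delta^(1/2) when [p >= 1]. There the bias bound has
    the larger exponent p/(p + 1), and the surplus power of [delta] is absorbed because the
    discrepancy principle bounds [delta] by a multiple of the source norm. The estimates on
    coefficients concern finite partial sums of squares, with a weighted inequality in place of the
    triangle inequality; only the discrepancy enters through a limit. *)

Section affine.
Context {R : realType}.
Local Notation mu := (@lebesgue_measure R).

Lemma measurable_affine (c d : R) :
  measurable_fun setT ((fun x => c * x + d) : measurableTypeR R -> measurableTypeR R).
Proof.
by apply: measurable_funD => //; apply: measurable_funM.
Qed.

(** Uniqueness of Lebesgue measure: the pushforward under the affine map, scaled by [c], gives
    half-open intervals their length. *)
Lemma lebesgue_measure_affine (c d : R) (A : set R) : 0 < c -> measurable A ->
  (c%:E * mu ((fun x => c * x + d)%R @^-1` A))%E = mu A.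
Proof.
move=> c0 mA.
pose m : {measure set (measurableTypeR R) -> \bar R} :=
  measure_function_pushforward__canonical__measure_function_Measure
    mu (measurable_affine c d).
pose m' : {measure set (measurableTypeR R) -> \bar R} :=
  mscale (NngNum (ltW c0)) m.
apply/esym; rewrite (@lebesgue_measure_unique R m')//.
move=> _ [[a b]] _ <-.
have -> : m' [set` `]a, b]] = (c%:E * mu ((fun x => c * x + d)%R @^-1` [set` `]a, b]]))%E by [].
rewrite (_ : _ @^-1` _ = `](a - d) / c, (b - d) / c]%classic).
  rewrite !lebesgue_measure_itv/= !lte_fin ltr_pM2r ?invr_gt0// ltrD2r.
  case: ifP => _; last by rewrite mule0.
  by rewrite -!EFinD -EFinM; congr EFin; field; rewrite gt_eqF.
apply/seteqP; split=> x /=; rewrite !in_itv/= ltr_pdivrMr// ler_pdivlMr//;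
  by rewrite ltrBlDr lerBrDr mulrC.
Qed.

(** The substitution is made on the measure, so [f] may be any nonnegative measurable function; the
    integrands below can be singular at the ends of [D]. *)
Lemma ge0_integral_affine (c d : R) (D : set R) (f : R -> \bar R) : 0 < c ->
  measurable D -> measurable_fun D f -> (forall x, D x -> 0 <= f x)%E ->
  (\int[mu]_(x in D) f x =
   c%:E * \int[mu]_(x in (fun x => c * x + d)%R @^-1` D) f (c * x + d)%R)%E.
Proof.
move=> c0 mD mf f0.
have /= <- := @ge0_integral_pushforward _ _ _ _ R _ (measurable_affine c d) mu D f mD mf _; last first.
  by move=> y /set_mem; exact: f0.
pose m : {measure set (measurableTypeR R) -> \bar R} :=
  measure_function_pushforward__canonical__measure_function_Measure
    mu (measurable_affine c d).
have := @ge0_integral_mscale _ _ R m D mD (NngNum (ltW c0)) f mf f0 => /= <-.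
apply: eq_measure_integral => A mA _.
exact/esym/(@lebesgue_measure_affine c d A c0 mA).
Qed.

End affine.

(** * Convergence of the Gamma integral and the product formula for the Beta integral *)

Section Gamma_Beta.
Context {R : realType}.
Local Notation mu := (@lebesgue_measure R).
Implicit Types a b t u x : R.

Let Gint a t : R := t `^ (a - 1) * expR (- t).

Let Gint_ge0 a t : 0 <= Gint a t.
Proof. by rewrite mulr_ge0 ?powR_ge0 ?expR_ge0. Qed.

Let measurable_Gint a (D : set R) : measurable_fun D (Gint a).
Proof.
apply: measurable_funTS; apply: measurable_funM.
  exact: measurable_powR.
by apply: measurableT_comp => //; exact: measurableT_comp.
Qed.

(** The integrand is unbounded at 0 when [a < 1], so ]0, 1] is exhausted by the intervals
    [1/(n + 1), 1]; there the antiderivative t^a / a bounds every integral by 1/a. *)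
Lemma integral_powR01_lty a : 0 < a ->
  (\int[mu]_(t in `]0%R, 1%R]) (t `^ (a - 1))%:E < +oo)%E.
Proof.
move=> a0.
pose F (n : nat) : set R := `[n.+1%:R^-1, 1]%classic.
have FU : \bigcup_n F n = `]0, 1]%classic.
  apply/seteqP; split=> [x [n _]|x]; rewrite /F /= !in_itv/= => /andP[x0 x1].
    by rewrite x1 (lt_le_trans _ x0)// invr_gt0.
  exists (Num.truncn x^-1) => //; rewrite /= in_itv/= x1 andbT.
  by rewrite -[leRHS]invrK lef_pV2 ?posrE ?invr_gt0// ltW// truncnS_gt.
have nd : nondecreasing_seq F.
  apply/nondecreasing_seqP => n; rewrite subsetEset => x; rewrite /F /= !in_itv/=.
  move=> /andP[x0 ->]; rewrite andbT (le_trans _ x0)// lef_pV2 ?posrE// ler_nat//.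
have mp : measurable_fun setT (fun t => (t `^ (a - 1))%:E).
  by apply/measurable_EFinP; exact: measurable_powR.
have p0 i x : F i x -> (0 <= (x `^ (a - 1))%:E)%E by rewrite lee_fin powR_ge0.
have : (\int[mu]_(x in F i) (x `^ (a - 1))%:E @[i --> \oo] -->
    \int[mu]_(x in \bigcup_i F i) (x `^ (a - 1))%:E)%E.
  apply: ge0_nondecreasing_set_cvg_integral => // i.
  - exact: measurable_itv.
  - exact: measurable_funTS.
rewrite FU => h.
apply: (@le_lt_trans _ _ a^-1%:E); last exact: ltry.
apply: (cvge_le _ h); apply: nearW => n.
(* For [n = 0] the interval is the single point 1, while the fundamental theorem of calculus is
   applied on proper intervals. *)
rewrite /F; case: n => [|n].
  rewrite invr1 (_ : [set` _] = [set 1]) ?integral_set1 ?lee_fin ?invr_ge0 ?ltW//.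
  by apply/seteqP; split=> x /=; rewrite in_itv/= -eq_le eq_sym => /eqP.
have dF x : 0 < x -> is_derive x 1 (fun t => a^-1 * t `^ a) (x `^ (a - 1)).
  move=> x0; have := @is_deriveZ _ _ _ _ a^-1 _ _ _ (is_derive1_powR a x0).
  by rewrite /GRing.scale/= mulrA mulVf ?gt_eqF// mul1r.
have cF x : 0 < x -> {for x, continuous (fun t : R => a^-1 * t `^ a)}.
  move=> x0; apply: differentiable_continuous; apply/derivable1_diffP.
  by have [] := dF x x0.
have n0 : 0 < n.+2%:R^-1 :> R by rewrite invr_gt0.
have n1 : n.+2%:R^-1 < 1 :> R by rewrite invf_lt1// ltr1n.
rewrite (@continuous_FTC2 _ _ (fun t => a^-1 * t `^ a)) //.
- by rewrite powR1 mulr1 -EFinD lee_fin gerBl mulr_ge0 ?powR_ge0 ?invr_ge0 ?ltW.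
- apply: continuous_in_subspaceT => x /set_mem/=; rewrite in_itv/= => /andP[x0 _].
  have {}x0 : 0 < x by exact: lt_le_trans x0.
  apply: differentiable_continuous; apply/derivable1_diffP.
  by have [] := is_derive1_powR (a - 1) x0.
- split.
  + move=> x; rewrite in_itv/= => /andP[x0 _].
    by have [] := dF x (lt_trans n0 x0).
  + by apply: cvg_at_right_filter; exact: cF.
  + by apply: cvg_at_left_filter; exact: cF.
- move=> x; rewrite in_itv/= => /andP[x0 _].
  by rewrite derive1E; have [_ ->] := dF x (lt_trans n0 x0).
Qed.

Lemma integral_expN_lty (c : R) : 0 < c ->
  (\int[mu]_(t in `[0%R, +oo[) (expR (- (c * t)))%:E < +oo)%E.
Proof.
move=> c0.
have dF x : is_derive x 1 (fun t => - c^-1 * expR (- (c * t))) (expR (- (c * x))).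
  apply: is_derive_eq; rewrite /GRing.scale/=.
  by field; rewrite gt_eqF.
rewrite (@ge0_continuous_FTC2y _ _ (fun t => - c^-1 * expR (- (c * t))) 0 0).
- by rewrite -EFinB ltry.
- by move=> x _; exact: expR_ge0.
- apply: continuous_subspaceT => x; apply: continuous_comp; last exact: continuous_expR.
  by apply: continuousN; apply: continuousM => //; exact: cst_continuous.
- rewrite -(mulr0 (- c^-1)); apply: cvgMr.
  apply: (@cvg_comp _ _ _ (fun t => c * t) (fun t => expR (- t)) _ +oo%R).
    by apply: gt0_cvgMry => //; exact: cvg_id.
  exact: cvgr_expR.
- by move=> x _; have [] := dF x.
- apply: cvg_at_right_filter.
  have : {for 0, continuous (fun t : R => - c^-1 * expR (- (c * t)))}.
    by apply: differentiable_continuous; apply/derivable1_diffP; have [] := dF 0.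
  by [].
- by move=> x _; rewrite derive1E; have [_ ->] := dF x.
Qed.

(** This is ln y <= y at y = t / (2a), multiplied by [a] and exponentiated. It serves the Gamma
    integral at infinity and, later, the comparison of powers of the eigenvalues with exponential
    weights. *)
Lemma powR_le_expR a t : 0 < a -> 0 < t ->
  t `^ a <= (2 * a) `^ a * expR (t / 2).
Proof.
move=> a0 t0; have a20 : 0 < 2 * a by rewrite mulr_gt0.
have ta0 : 0 < t / (2 * a) by rewrite divr_gt0.
rewrite -[X in X `^ a](@divfK _ (2 * a)) ?gt_eqF// (powRM _ (ltW ta0) (ltW a20)).
rewrite [leLHS]mulrC ler_wpM2l ?powR_ge0// /powR gt_eqF ?divr_gt0// ler_expR.
rewrite (_ : t / 2 = a * (t / (2 * a))); last by field; rewrite gt_eqF.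
by rewrite ler_wpM2l// ltW// ln_sublinear// divr_gt0.
Qed.

Lemma Gamma_int_lty a : 0 < a ->
  (\int[mu]_(t in `]0%R, +oo[) (t `^ (a - 1) * expR (- t))%:E < +oo)%E.
Proof.
move=> a0; rewrite -[ltLHS]/(\int[mu]_(t in `]0%R, +oo[) (Gint a t)%:E)%E.
have mG (D : set R) : measurable_fun D (EFin \o Gint a).
  by apply/measurable_EFinP; exact: measurable_Gint.
rewrite (_ : `]0%R, +oo[%classic = `]0%R, 1%R] `|` `]1%R, +oo[); last first.
  apply/seteqP; split=> x /=; rewrite !in_itv/= !andbT.
    by move=> ->; case: (leP x 1) => _; [left|right].
  by case=> [/andP[]//|]; exact: lt_trans.
rewrite ge0_integral_setU//=.
- rewrite lte_add_pinfty//.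
    apply: (le_lt_trans _ (integral_powR01_lty a a0)); apply: (@ge0_le_integral _ _ R mu) => //=.
    + by move=> x _; rewrite lee_fin.
    + exact: mG.
    + apply/measurable_EFinP; apply: measurable_funTS; exact: measurable_powR.
    + move=> x; rewrite in_itv/= => /andP[x0 _]; rewrite lee_fin ler_piMr ?powR_ge0//.
      by rewrite -expR0 ler_expR oppr_le0 ltW.
  pose K := (2 * a) `^ a.
  have mE c : measurable_fun setT (fun t : R => expR (- (c * t))).
    by apply: measurableT_comp => //; apply: measurableT_comp => //; exact: measurable_funM.
  apply: (@le_lt_trans _ _ (\int[mu]_(t in `[0%R, +oo[) (K * expR (- (2^-1 * t)))%:E)%E).
    apply: (@le_trans _ _ (\int[mu]_(t in `]1%R, +oo[) (K * expR (- (2^-1 * t)))%:E)%E).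
      apply: ge0_le_integral => //=.
      + by move=> x _; rewrite lee_fin.
      + exact: mG.
      + by apply/measurable_EFinP; apply: measurable_funTS; apply: measurable_funM => //; exact: mE.
      + move=> x; rewrite in_itv/= andbT => x1; rewrite lee_fin.
        apply: (@le_trans _ _ (x `^ a * expR (- x))).
          by rewrite ler_pM2r ?expR_gt0// ler_powR ?gerBl// ltW.
        have := powR_le_expR a x a0 (lt_trans ltr01 x1).
        rewrite -(ler_pM2r (expR_gt0 (- x))) => /le_trans; apply.
        by rewrite -mulrA -expRD /K (_ : x / 2 - x = - (2^-1 * x))//; field.
    apply: ge0_subset_integral => //=.
    + by apply/measurable_EFinP; apply: measurable_funTS; apply: measurable_funM => //; exact: mE.
    + by move=> x _; rewrite lee_fin mulr_ge0 ?powR_ge0 ?expR_ge0.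
    + by move=> x; rewrite /= !in_itv/= !andbT => /ltW; apply: le_trans.
  under eq_integral do rewrite EFinM.
  rewrite ge0_integralZl//=.
  + rewrite lte_mul_pinfty ?lee_fin ?powR_ge0//.
    by apply: integral_expN_lty; rewrite invr_gt0.
  + by apply/measurable_EFinP; apply: measurable_funTS; exact: mE.
  + by rewrite lee_fin powR_ge0.
- exact: mG.
- by move=> x _; rewrite lee_fin.
- apply/disj_setPS => x /=; rewrite !in_itv/= andbT => -[/andP[_ x1]] /(le_lt_trans x1).
  by rewrite ltxx.
Qed.

(** [Gamma] is the finite part of this integral, so the identity rests on convergence; it carries
    [Gamma] to the extended reals, where Tonelli applies. *)
Lemma EFin_Gamma a : 0 < a ->
  (Gamma a)%:E = (\int[mu]_(t in `]0%R, +oo[) (t `^ (a - 1) * expR (- t))%:E)%E.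
Proof.
move=> a0; rewrite /Gamma /Rintegral fineK// ge0_fin_numE ?Gamma_int_lty//.
by apply: integral_ge0 => t _; rewrite lee_fin Gint_ge0.
Qed.

Lemma Gamma_gt0 a : 0 < a -> 0 < Gamma a.
Proof.
move=> a0; rewrite -lte_fin EFin_Gamma//.
(* On [1, 2] one has t^(a - 1) >= 1/t >= 1/2 and exp(-t) >= exp(-2). *)
apply: (@lt_le_trans _ _ (\int[mu]_(t in `[1%R, 2%R]) (2^-1 * expR (- 2))%:E)%E).
  rewrite integral_cst//= lebesgue_measure_itv/= lte_fin ltr1n.
  by rewrite -EFinD -EFinM lte_fin !mulr_gt0 ?expR_gt0// (_ : 2 - 1 = 1) //; ring.
apply: (@le_trans _ _ (\int[mu]_(t in `[1%R, 2%R]) (Gint a t)%:E)%E).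
  apply: ge0_le_integral => //=.
  - by apply/measurable_EFinP; exact: measurable_Gint.
  - move=> x; rewrite in_itv/= => /andP[x1 x2]; rewrite lee_fin /Gint.
    apply: ler_pM; rewrite ?expR_ge0 ?ler_expR ?lerN2//.
    apply: (@le_trans _ _ (x `^ (- 1))); last by rewrite ler_powR// lerDr ltW.
    by rewrite powR_inv1 ?lef_pV2 ?posrE// ?(le_trans _ x1)// (lt_le_trans _ x1).
apply: ge0_subset_integral => //=.
- by apply/measurable_EFinP; exact: measurable_Gint.
- by move=> x _; rewrite lee_fin Gint_ge0.
- by move=> x; rewrite /= !in_itv/= andbT => /andP[x1 _]; exact: lt_le_trans x1.
Qed.

(** Valued in the extended reals, so that finiteness is a consequence of the product formula and not
    a precondition for stating it. *)
Definition Beta_int a b : \bar R :=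
  \int[mu]_(s in `]0%R, 1%R[) (s `^ (a - 1) * (1 - s) `^ (b - 1))%:E.

Lemma integral_Beta a b t : 0 < t ->
  (\int[mu]_(s in `]0%R, t[) (s `^ (a - 1) * (t - s) `^ (b - 1))%:E =
   (t `^ (a + b - 1))%:E * Beta_int a b)%E.
Proof.
move=> t0.
have mB (u : R) : measurable_fun setT (fun s : R => (s `^ (a - 1) * (u - s) `^ (b - 1))%:E).
  apply/measurable_EFinP; apply: measurable_funM; first exact: measurable_powR.
  have h : measurable_fun [set: R] (fun s : R => u - s) by exact: measurable_funB.
  exact: (measurableT_comp (@measurable_powR R (b - 1)) h).
rewrite (@ge0_integral_affine _ t 0 `]0%R, t[%classic
  (fun s => (s `^ (a - 1) * (t - s) `^ (b - 1))%:E) t0 (measurable_itv _)); last 2 first.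
- exact: measurable_funTS (mB t).
- by move=> x _; rewrite lee_fin mulr_ge0 ?powR_ge0.
rewrite (_ : _ @^-1` _ = `]0%R, 1%R[%classic); last first.
  apply/seteqP; split=> x /=; rewrite !in_itv/= addr0 pmulr_rgt0// ?gtr_pMr//.
under eq_integral => x.
  rewrite inE/= in_itv/= => /andP[x0 x1].
  have x1' : 0 < 1 - x by rewrite subr_gt0.
  rewrite addr0 (powRM _ (ltW t0) (ltW x0)) (_ : t - t * x = t * (1 - x)); last by ring.
  rewrite (powRM _ (ltW t0) (ltW x1')) mulrACA -powRD; last by rewrite (gt_eqF t0) implybT.
  rewrite EFinM; over.
rewrite ge0_integralZl//=; last 3 first.
- exact: measurable_funTS (mB 1).
- by move=> x _; rewrite lee_fin mulr_ge0 ?powR_ge0.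
- by rewrite lee_fin powR_ge0.
rewrite muleA -EFinM -[X in X * _](powRr1 (ltW t0)) -powRD; last by rewrite (gt_eqF t0) implybT.
by rewrite (_ : 1 + _ = a + b - 1)//; ring.
Qed.

(** Tonelli for x^(a - 1) (u - x)^(b - 1) exp(-u) on 0 < x < u. Integrating in [u] after the shift u
    = x + v gives the product of the Gammas; integrating in [x] by scaling gives u^(a + b - 1)
    exp(-u) times the Beta integral. *)
Theorem Gamma_mul_Beta a b : 0 < a -> 0 < b ->
  ((Gamma a * Gamma b)%:E = (Gamma (a + b))%:E * Beta_int a b)%E.
Proof.
move=> a0 b0.
pose A : set (measurableTypeR R * measurableTypeR R) := [set z | 0 < z.1 < z.2].
pose g (z : measurableTypeR R * measurableTypeR R) : R :=
  z.1 `^ (a - 1) * (z.2 - z.1) `^ (b - 1) * expR (- z.2).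
pose f z : \bar R := if z \in A then (g z)%:E else 0%E.
have g0 z : 0 <= g z by rewrite !mulr_ge0 ?powR_ge0 ?expR_ge0.
have m1 : measurable_fun setT (fst : measurableTypeR R * measurableTypeR R -> measurableTypeR R).
  exact: measurable_fst.
have m2 : measurable_fun setT (snd : measurableTypeR R * measurableTypeR R -> measurableTypeR R).
  exact: measurable_snd.
have mg : measurable_fun setT g.
  apply: measurable_funM; last first.
    by apply: measurableT_comp => //; exact: measurableT_comp.
  apply: measurable_funM.
    exact: (measurableT_comp (@measurable_powR R (a - 1)) m1).
  exact: (measurableT_comp (@measurable_powR R (b - 1)) (measurable_funB m2 m1)).
have mA : measurable A.
  rewrite (_ : A = (fst @^-1` `]0, +oo[) `&` ((fun z => z.2 - z.1) @^-1` `]0, +oo[)).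
    apply: measurableI; rewrite -[X in measurable X]setTI.
      exact: m1.
    by apply: (measurable_funB m2 m1).
  apply/seteqP; split=> z; rewrite /A/= !in_itv/= !andbT subr_gt0; first by move=> /andP.
  by move=> [-> ->].
have mf : measurable_fun setT f.
  apply/(measurable_restrictT (EFin \o g)) => //.
  by apply: measurable_funTS; apply/measurable_EFinP.
have f0 z : (0 <= f z)%E by rewrite /f; case: ifP => // _; rewrite lee_fin.
have memA x u : ((x, u) \in A) = (0 < x < u) by apply/idP/idP; rewrite inE.
have f1 x : (\int[mu]_u f (x, u) =
    if (0 < x)%R then (Gint a x)%:E * (Gamma b)%:E else 0)%E.
  have [x0|x0] := ltP 0 x; last first.
    by apply: integral0_eq => u _; rewrite /f memA ltNge x0.
  transitivity (\int[mu]_(u in `]x, +oo[) (g (x, u))%:E)%E.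
    rewrite [RHS]integral_mkcond; apply: eq_integral => u _.
    by rewrite /f patchE memA mem_setE in_itv/= andbT x0.
  rewrite (@ge0_integral_affine _ 1 x `]x, +oo[%classic (fun u => (g (x, u))%:E) ltr01
    (measurable_itv _)); last 2 first.
  - apply: measurable_funTS; apply/measurable_EFinP.
    exact: (measurableT_comp mg (measurable_pair1 _)).
  - by move=> u _; rewrite lee_fin.
  rewrite mul1e (_ : _ @^-1` _ = `]0%R, +oo[%classic); last first.
    by apply/seteqP; split=> u /=; rewrite !in_itv/= !andbT mul1r ltrDr.
  transitivity (\int[mu]_(u in `]0%R, +oo[) ((Gint a x)%:E * (Gint b u)%:E))%E.
    apply: eq_integral => u _; rewrite /g/= mul1r addrK opprD expRD -EFinM.
    by congr EFin; rewrite /Gint; ring.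
  rewrite ge0_integralZl//=.
  - by rewrite EFin_Gamma.
  - by apply/measurable_EFinP; exact: measurable_Gint.
  - by move=> u _; rewrite lee_fin.
  - by rewrite lee_fin.
have f2 u : (\int[mu]_x f (x, u) =
    if (0 < u)%R then (Gint (a + b) u)%:E * Beta_int a b else 0)%E.
  have [u0|u0] := ltP 0 u; last first.
    apply: integral0_eq => x _; rewrite /f memA; case: ifP => // /andP[x0 xu].
    by have := lt_trans x0 xu; rewrite ltNge u0.
  transitivity (\int[mu]_(x in `]0%R, u[)
      ((expR (- u))%:E * (x `^ (a - 1) * (u - x) `^ (b - 1))%:E))%E.
    rewrite [RHS]integral_mkcond; apply: eq_integral => x _.
    rewrite /f patchE memA mem_setE in_itv/=; case: ifP => // _.
    by rewrite -EFinM mulrC.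
  rewrite (@ge0_integralZl _ _ R mu _ (measurable_itv _)
    (fun x => (x `^ (a - 1) * (u - x) `^ (b - 1))%:E)).
  - by rewrite integral_Beta// muleA -EFinM /Gint mulrC.
  - apply/measurable_EFinP; apply: measurable_funM.
      by apply: measurable_funTS; exact: measurable_powR.
    apply: measurable_funTS.
    have h : measurable_fun [set: R] (fun s : R => u - s) by exact: measurable_funB.
    exact: (measurableT_comp (@measurable_powR R (b - 1)) h).
  - by move=> x _; rewrite lee_fin mulr_ge0 ?powR_ge0.
  - by rewrite lee_fin expR_ge0.
have L : (\int[mu]_x \int[mu]_u f (x, u) = (Gamma a)%:E * (Gamma b)%:E)%E.
  transitivity (\int[mu]_(x in `]0%R, +oo[) ((Gint a x)%:E * (Gamma b)%:E))%E.
    rewrite [RHS]integral_mkcond; apply: eq_integral => x _.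
    by rewrite f1 patchE mem_setE in_itv/= andbT.
  rewrite (@ge0_integralZr _ _ R mu _ (measurable_itv _) (EFin \o Gint a)).
  - by rewrite -(EFin_Gamma a a0).
  - by apply/measurable_EFinP; exact: measurable_Gint.
  - by move=> x _; rewrite lee_fin.
  - by rewrite lee_fin ltW// Gamma_gt0.
rewrite EFinM -L (@fubini_tonelli _ _ _ _ R mu mu f mf f0).
transitivity (\int[mu]_(x in `]0%R, +oo[) ((Gint (a + b) x)%:E * Beta_int a b))%E.
  rewrite [RHS]integral_mkcond; apply: eq_integral => x _.
  by rewrite f2 patchE mem_setE in_itv/= andbT.
rewrite (@ge0_integralZr _ _ R mu _ (measurable_itv _) (EFin \o Gint (a + b))).
- by rewrite EFin_Gamma// addr_gt0.
- by apply/measurable_EFinP; exact: measurable_Gint.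
- by move=> x _; rewrite lee_fin.
- by apply: integral_ge0 => x _; rewrite lee_fin mulr_ge0 ?powR_ge0.
Qed.

Lemma Beta_intE a b : 0 < a -> 0 < b ->
  Beta_int a b = (Gamma a * Gamma b / Gamma (a + b))%:E.
Proof.
move=> a0 b0; have G0 := Gamma_gt0 _ (addr_gt0 a0 b0).
apply/esym; rewrite mulrC EFinM Gamma_mul_Beta// muleA -EFinM.
by rewrite mulVf ?gt_eqF// mul1e.
Qed.

End Gamma_Beta.

(** * The Kilbas-Saigo function *)

Section power_series.
Context {R : realType}.

Lemma ratio_half_cvg_series (a : nat -> R) (M : nat) :
  (forall k, 0 <= a k) -> (forall k, (M <= k)%N -> a k.+1 <= 2^-1 * a k) ->
  cvgn (series a).
Proof.
move=> a0 ha.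
(* The factor [2 ^+ M] makes the geometric bound dominate the terms up to index [M] as well, where
   no ratio estimate is available. *)
pose C := 2 ^+ M * \sum_(0 <= j < M.+1) a j.
have hC k : a k <= geometric C 2^-1 k.
  elim: k => [|k ih] /=.
    rewrite expr0 mulr1 /C big_nat_recl// mulrDr.
    rewrite -[leLHS]addr0 lerD// ?mulr_ge0 ?exprn_ge0 ?sumr_ge0//.
    by rewrite ler_peMl// exprn_ege1// ler1n.
  have [Mk|kM] := leqP M k.
    by rewrite (le_trans (ha _ Mk))// exprS mulrCA ler_pM2l// invr_gt0.
  rewrite /C exprVn mulrAC.
  apply: (@le_trans _ _ (\sum_(0 <= j < M.+1) a j)).
    rewrite (big_cat_nat _ (n := k.+1))//=; last by rewrite ltnW.
    rewrite [X in _ + X]big_ltn//.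
    by rewrite addrCA lerDl addr_ge0// sumr_ge0.
  rewrite ler_peMl ?sumr_ge0// ler_pdivlMr ?exprn_gt0// mul1r.
  by rewrite ler_weXn2l// ler1n.
apply: (series_le_cvg a0 _ hC).
- by move=> n /=; rewrite mulr_ge0 ?exprn_ge0 ?mulr_ge0 ?sumr_ge0.
- by apply: is_cvg_geometric_series; rewrite ger0_norm ?invf_lt1 ?ltr1n.
Qed.

(** The crude factor [(2 * X) ^+ k], in place of k X^(k - 1), lets a termwise estimate sum up to the
    same power series at [2 * X]. *)
Lemma dist_exprn_le (X x y : R) k : 1 <= X -> `|x| <= X -> `|y| <= X ->
  `|x ^+ k - y ^+ k| <= (2 * X) ^+ k * `|x - y|.
Proof.
move=> X1 xX yX; have X0 : 0 <= X by exact: le_trans X1.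
elim: k => [|k ih]; first by rewrite !expr0 subrr normr0 mul1r.
rewrite (_ : x ^+ k.+1 - y ^+ k.+1 = x * (x ^+ k - y ^+ k) + y ^+ k * (x - y)); last first.
  by rewrite !exprS; ring.
rewrite (le_trans (ler_normD _ _))// !normrM normrX.
apply: (@le_trans _ _ (X * ((2 * X) ^+ k * `|x - y|) + X * (2 * X) ^+ k * `|x - y|)).
  apply: lerD; first exact: ler_pM.
  rewrite ler_wpM2r//; apply: (@le_trans _ _ (X ^+ k)); first by rewrite lerXn2r// nnegrE.
  apply: (@le_trans _ _ ((2 * X) ^+ k)).
    by rewrite lerXn2r// ?nnegrE ?mulr_ge0// ler_peMl// ler1n.
  by rewrite ler_peMl// exprn_ge0// mulr_ge0.
by rewrite exprS le_eqVlt; apply/orP; left; apply/eqP; ring.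
Qed.

End power_series.

(** * The Kilbas-Saigo series and its Volterra equation *)

Section KilbasSaigo_series.
Context {R : realType}.
Variables al be : R.
Hypotheses (al_gt0 : 0 < al) (be_ge0 : 0 <= be).
Local Notation mu := (@lebesgue_measure R).
Local Notation ga := (al + be).

Let ga_gt0 : 0 < ga. Proof. exact: ltr_wpDr. Qed.

Definition KS_ratio (j : nat) : R :=
  Gamma (j%:R * ga + 1 - al) / Gamma (j%:R * ga + 1).

Definition KS_coef (k : nat) : R := \prod_(0 <= j < k) KS_ratio j.+1.

(* [KS_fun x] is [E_(al, 1 + be/al, be/al)(- x)], whose Gamma quotients simplify
   to [KS_ratio] since [al * (1 + be/al) = al + be]; dropping its constant term
   and shifting the index gives the series [E_(al, 1 + be/al, 1 + 2 be/al)]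
   occurring in [sigma]. *)
Definition KS_fun (x : R) : R := limn (series (fun k => KS_coef k * (- x) ^+ k)).

Let arg_gt0 k : 0 < be + k%:R * ga + 1.
Proof. by rewrite ltr_wpDl// addr_ge0// mulr_ge0// ltW. Qed.

(** Writing the ratios as Beta integrals does double duty: it gives their limit 0, and it identifies
    them as the factors by which the Volterra kernel acts on powers. *)
Lemma KS_ratio_Beta k :
  Beta_int (be + k%:R * ga + 1) al = (Gamma al * KS_ratio k.+1)%:E.
Proof.
rewrite Beta_intE// /KS_ratio -natr1.
rewrite (_ : be + k%:R * ga + 1 = (k%:R + 1) * ga + 1 - al); last by ring.
by rewrite subrK mulrCA mulrA.
Qed.

Lemma KS_ratio_gt0 k : 0 < KS_ratio k.+1.
Proof.
rewrite /KS_ratio divr_gt0 ?Gamma_gt0//.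
  rewrite (_ : k.+1%:R * ga + 1 - al = be + k%:R * ga + 1)//.
  by rewrite -natr1; ring.
by rewrite ltr_wpDl// mulr_ge0// ltW.
Qed.

Lemma KS_coef_gt0 k : 0 < KS_coef k.
Proof. by apply: prodr_gt0 => j _; exact: KS_ratio_gt0. Qed.

Lemma KS_coef0 : KS_coef 0 = 1.
Proof. by rewrite /KS_coef big_geq. Qed.

Lemma KS_coefS k : KS_coef k.+1 = KS_coef k * KS_ratio k.+1.
Proof. by rewrite /KS_coef big_nat_recr. Qed.

Lemma Beta_int_fin a b : 0 < a -> 0 < b -> (Beta_int a b < +oo :> \bar R)%E.
Proof. by move=> a0 b0; rewrite Beta_intE// ltry. Qed.

Let measurable_Bint a b t (D : set R) :
  measurable_fun D (fun s : R => s `^ (a - 1) * (t - s) `^ (b - 1)).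
Proof.
apply: measurable_funTS; apply: measurable_funM; first exact: measurable_powR.
have h : measurable_fun [set: R] (fun s : R => t - s) by exact: measurable_funB.
exact: (measurableT_comp (@measurable_powR R (b - 1)) h).
Qed.

(** Dominated convergence in the Beta integral replaces Gamma asymptotics: s^(k ga) tends to 0 on
    ]0, 1[ and the integrands stay below (1 - s)^(al - 1). *)
Lemma KS_ratio_cvg0 : KS_ratio k.+1 @[k --> \oo] --> 0.
Proof.
pose f (k : nat) (s : R) : \bar R := (s `^ (be + k%:R * ga + 1 - 1) * (1 - s) `^ (al - 1))%:E.
(* The trivial power with exponent [1 - 1] is kept so that the integral of [g] is literally
   [Beta_int 1 al]. *)
pose g (s : R) : \bar R := (s `^ (1 - 1) * (1 - s) `^ (al - 1))%:E.
have ig : mu.-integrable `]0, 1[ g.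
  apply/integrableP; split.
    by apply/measurable_EFinP; exact: measurable_Bint.
  under eq_integral do rewrite /g gee0_abs ?lee_fin ?mulr_ge0 ?powR_ge0//.
  exact: Beta_int_fin.
have bd : {ae mu, forall s n, `]0, 1[%classic s -> (`|f n s| <= g s)%E}.
  apply: aeW => s n /=; rewrite in_itv/= => /andP[s0 s1].
  rewrite /f /g /= lee_fin ger0_norm ?mulr_ge0 ?powR_ge0//.
  rewrite ler_wpM2r ?powR_ge0// ger_powR// ?s0 ?(ltW s1)// lerD2r lerDr.
  by rewrite addr_ge0// mulr_ge0// ltW.
have cv : {ae mu, forall s, `]0, 1[%classic s -> f ^~ s @ \oo --> (cst 0%E : R -> \bar R) s}.
  apply: aeW => s /=; rewrite in_itv/= => /andP[s0 s1].
  apply: cvg_EFin; first exact: nearW.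
  have -> : fine \o f ^~ s = (fun k : nat => (s `^ be * (1 - s) `^ (al - 1)) * (s `^ ga) ^+ k).
    apply/funext => k; rewrite /f/= addrK powRD; last by rewrite (gt_eqF s0) implybT.
    by rewrite (mulrC k%:R) powRrM powR_mulrn ?powR_ge0// mulrAC.
  rewrite -[X in _ --> X](mulr0 (s `^ be * (1 - s) `^ (al - 1))).
  apply: cvgMr; apply: cvg_expr; rewrite ger0_norm ?powR_ge0//.
  by rewrite -(powRr0 s) /powR (gt_eqF s0) ltr_expR mul0r pmulr_rlt0// ln_lt0// s0.
have mf n : measurable_fun (`]0, 1[%classic : set R) (f n).
  by apply/measurable_EFinP; exact: measurable_Bint.
have [_ _] := @dominated_convergence _ _ _ mu `]0, 1[%classic (measurable_itv _) f (cst 0%E) g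
  mf (measurable_cst _) cv ig bd.
rewrite integral0 => h.
have {}h : Gamma al * KS_ratio k.+1 @[k --> \oo] --> 0.
  have : (Gamma al * KS_ratio k.+1)%:E @[k --> \oo] --> 0%:E.
    apply: cvg_trans h; apply: near_eq_cvg; apply: nearW => k /=.
    by rewrite -KS_ratio_Beta.
  exact: fine_cvg.
have G0 := Gamma_gt0 _ al_gt0.
rewrite (_ : (fun k => _) = (fun k => (Gamma al)^-1 * (Gamma al * KS_ratio k.+1))).
  by rewrite -(mulr0 (Gamma al)^-1); exact: cvgMr.
by apply/funext => k; rewrite mulrA mulVf ?gt_eqF// mul1r.
Qed.

Lemma KS_cvg x : 0 <= x -> cvgn (series (fun k => KS_coef k * x ^+ k)).
Proof.
move=> x0.
have c0 k : 0 <= KS_coef k * x ^+ k by rewrite mulr_ge0 ?exprn_ge0// ltW// KS_coef_gt0.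
have : \forall k \near \oo, x * KS_ratio k.+1 < 2^-1.
  have : x * KS_ratio k.+1 @[k --> \oo] --> 0.
    by rewrite -(mulr0 x); apply: cvgMr; exact: KS_ratio_cvg0.
  by move=> /cvgrPdist_lt /(_ 2^-1) h; near do rewrite (le_lt_trans (ler_norm _))// -normrN -sub0r; apply: h.
move=> [M _ hM]; apply: (@ratio_half_cvg_series _ _ M) => // k Mk.
rewrite KS_coefS exprS (_ : _ * _ * _ = (x * KS_ratio k.+1) * (KS_coef k * x ^+ k)); last by ring.
by rewrite ler_wpM2r// ltW// hM.
Unshelve. all: by end_near. Qed.

(** The series with all signs made positive. It dominates every partial sum, and its value at
    [2 * X] is a Lipschitz constant on [0, X]. *)
Definition KS_major (x : R) : R := limn (series (fun k => KS_coef k * x ^+ k)).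

Lemma KS_partial_le_major x y n : 0 <= x -> `|y| <= x ->
  `|series (fun k => KS_coef k * y ^+ k) n| <= KS_major x.
Proof.
move=> x0 yx; rewrite /series/=.
apply: (@le_trans _ _ (series (fun k => KS_coef k * x ^+ k) n)).
  rewrite (le_trans (ler_norm_sum _ _ _))//; apply: ler_sum => k _.
  rewrite normrM normrX (ger0_norm (ltW (KS_coef_gt0 k))) ler_pM2l ?KS_coef_gt0//.
  by rewrite lerXn2r ?nnegrE.
apply: nondecreasing_cvgn_le; last exact: KS_cvg.
apply: nondecreasing_series => k _ _.
by rewrite mulr_ge0 ?exprn_ge0// ltW// KS_coef_gt0.
Qed.

Lemma KS_major_ge0 x : 0 <= x -> 0 <= KS_major x.
Proof.
move=> x0; have := KS_partial_le_major x 0 0 x0.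
by rewrite normr0 => /(_ x0); apply: le_trans.
Qed.

Lemma KS_fun_cvg x : 0 <= x -> series (fun k => KS_coef k * (- x) ^+ k) n @[n --> \oo] --> KS_fun x.
Proof.
move=> x0; apply: normed_cvg.
suff e : [normed series (fun k => KS_coef k * (- x) ^+ k)] = series (fun k => KS_coef k * x ^+ k).
  by rewrite e; exact: KS_cvg.
apply/funext => n; rewrite /series/=; apply: eq_bigr => k _.
rewrite normrM normrX normrN (ger0_norm x0).
by rewrite ger0_norm// ltW// KS_coef_gt0.
Qed.

Lemma KS_fun0 : KS_fun 0 = 1.
Proof.
apply/cvg_lim => //; apply: cvg_near_cst.
exists 1%N => // n /= n0; rewrite /series/= big_ltn//= big1_seq.
  by rewrite KS_coef0 mul1r addr0.
move=> [|i] /andP[_]; first by rewrite mem_index_iota.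
by rewrite oppr0 expr0n mulr0.
Qed.

Lemma KS_fun_lipschitz X x y : 1 <= X -> 0 <= x <= X -> 0 <= y <= X ->
  `|KS_fun x - KS_fun y| <= KS_major (2 * X) * `|x - y|.
Proof.
move=> X1 /andP[x0 xX] /andP[y0 yX].
have X0 : 0 <= 2 * X by rewrite mulr_ge0// (le_trans _ X1).
have h : `|series (fun k => KS_coef k * (- x) ^+ k) n - series (fun k => KS_coef k * (- y) ^+ k) n|
    @[n --> \oo] --> `|KS_fun x - KS_fun y|.
  by apply: cvg_norm; apply: cvgB; exact: KS_fun_cvg.
rewrite -(cvg_lim _ h)//; apply: limr_le; first by apply/cvg_ex; eexists; exact: h.
apply: nearW => n; rewrite /series/= -sumrB.
apply: (@le_trans _ _ (series (fun k => KS_coef k * (2 * X) ^+ k) n * `|x - y|)); last first.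
  rewrite ler_wpM2r// (le_trans (ler_norm _))// KS_partial_le_major//.
  by rewrite ger0_norm.
rewrite /series/= mulr_suml (le_trans (ler_norm_sum _ _ _))//; apply: ler_sum => k _.
rewrite -mulrBr normrM (ger0_norm (ltW (KS_coef_gt0 k))) -mulrA ler_pM2l ?KS_coef_gt0//.
have := @dist_exprn_le _ X (- x) (- y) k X1.
rewrite (_ : - x - - y = - (x - y)); last by ring.
by rewrite !normrN (ger0_norm x0) (ger0_norm y0); apply.
Qed.

(* The solution of the relaxation equation [D^al u = - t^be u], [u(0) = 1]. *)
Definition KS_sol (t : R) : R := KS_fun (t `^ ga).

Definition KS_kern (t s : R) : R := s `^ be * (t - s) `^ (al - 1).

Lemma KS_kern_ge0 t s : 0 <= KS_kern t s.
Proof. by rewrite mulr_ge0 ?powR_ge0. Qed.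

Lemma measurable_KS_kern t (D : set R) : measurable_fun D (KS_kern t).
Proof. by have := measurable_Bint (be + 1) al t D; rewrite addrK. Qed.

(** The kernel is homogeneous: integration raises the power [k] of s^ga to the power [k.+1] of t^ga.
    This is what singles out the variable t^ga in [KS_sol]. *)
Lemma integral_KS_kern k t : 0 < t ->
  (\int[mu]_(s in `]0%R, t[) (KS_kern t s * (s `^ ga) ^+ k)%:E =
   (Gamma al * KS_ratio k.+1 * (t `^ ga) ^+ k.+1)%:E)%E.
Proof.
move=> t0; have := @integral_Beta R (be + k%:R * ga + 1) al t t0.
rewrite KS_ratio_Beta -EFinM.
rewrite (_ : be + k%:R * ga + 1 + al - 1 = ga * k.+1%:R); last by rewrite -natr1; ring.
rewrite powRrM powR_mulrn ?powR_ge0// [X in X%:E]mulrC => <-.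
apply: eq_integral => s; rewrite inE/= in_itv/= => /andP[s0 _].
rewrite /KS_kern addrK (@powRD _ s be); last by rewrite (gt_eqF s0) implybT.
by rewrite (mulrC k%:R) powRrM powR_mulrn ?powR_ge0// mulrAC.
Qed.

Lemma measurable_powRX k (D : set R) : measurable_fun D (fun s : R => (s `^ ga) ^+ k).
Proof. by apply: measurable_funX; apply: measurable_funTS; exact: measurable_powR. Qed.

Lemma integrable_KS_kernX k t : 0 < t ->
  mu.-integrable `]0, t[ (fun s => (KS_kern t s * (s `^ ga) ^+ k)%:E).
Proof.
move=> t0; apply/integrableP; split.
  by apply/measurable_EFinP; apply: measurable_funM; [exact: measurable_KS_kern|exact: measurable_powRX].
under eq_integral do rewrite gee0_abs ?lee_fin ?mulr_ge0 ?exprn_ge0 ?powR_ge0//.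
by rewrite integral_KS_kern// ltry.
Qed.

(** The series is integrated term by term; a constant multiple of the kernel dominates the partial
    sums on ]0, t[. *)
Lemma KS_volterra t : 0 < t ->
  mu.-integrable `]0, t[ (fun s => (KS_kern t s * KS_sol s)%:E) /\
  (\int[mu]_(s in `]0%R, t[) (KS_kern t s * KS_sol s)%:E = (Gamma al * (1 - KS_sol t))%:E)%E.
Proof.
move=> t0.
pose P (n : nat) (y : R) := series (fun k => KS_coef k * y ^+ k) n.
pose f (n : nat) (s : R) : \bar R := (KS_kern t s * P n (- (s `^ ga)))%:E.
pose M := KS_major (t `^ ga).
have fE n s : f n s = (\sum_(0 <= k < n)
    ((KS_coef k * (-1) ^+ k)%:E * (KS_kern t s * (s `^ ga) ^+ k)%:E))%E.
  rewrite /f /P /series/= mulr_sumr -sumEFin; apply: eq_bigr => k _.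
  rewrite -EFinM (exprNn (s `^ ga)); congr EFin.
  by move: ((-1) ^+ k) ((_ `^ _) ^+ k) => e1 e2; ring.
have mf n : measurable_fun (`]0, t[%classic : set R) (f n).
  apply/measurable_EFinP; apply: measurable_funM; first exact: measurable_KS_kern.
  apply: measurable_sum => k; apply: measurable_funM => //.
  apply: measurable_funX; apply: measurableT_comp => //.
  by apply: measurable_funTS; exact: measurable_powR.
have cvP s : P n (- (s `^ ga)) @[n --> \oo] --> KS_sol s.
  by apply: KS_fun_cvg; exact: powR_ge0.
have mg : measurable_fun (`]0, t[%classic : set R) (fun s => (KS_kern t s * KS_sol s)%:E).
  apply: (@emeasurable_fun_cvg _ _ _ _ f) => //.
  by move=> s _; apply: cvg_EFin; [exact: nearW|apply: cvgMr; exact: cvP].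
have cv : {ae mu, forall s, `]0, t[%classic s -> f ^~ s @ \oo --> (KS_kern t s * KS_sol s)%:E}.
  by apply: aeW => s _; apply: cvg_EFin; [exact: nearW|apply: cvgMr; exact: cvP].
have ig : mu.-integrable `]0, t[ (fun s => (M%:E * (KS_kern t s * (s `^ ga) ^+ 0)%:E)%E).
  by apply: integrableZl => //; exact: integrable_KS_kernX.
have bd : {ae mu, forall s n, `]0, t[%classic s ->
    (`|f n s| <= M%:E * (KS_kern t s * (s `^ ga) ^+ 0)%:E)%E}.
  apply: aeW => s n /=; rewrite in_itv/= => /andP[s0 st].
  rewrite /f -EFinM lee_fin expr0 mulr1 normrM (ger0_norm (KS_kern_ge0 t s)) [leRHS]mulrC.
  rewrite ler_wpM2l ?KS_kern_ge0// KS_partial_le_major ?powR_ge0// normrN ger0_norm ?powR_ge0//.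
  by rewrite ge0_ler_powR ?nnegrE// ltW.
have [ig' _ cvi] := @dominated_convergence _ _ _ mu `]0, t[%classic (measurable_itv _) f
  (fun s => (KS_kern t s * KS_sol s)%:E) _ mf mg cv ig bd.
split => //; apply: (cvg_unique _ cvi) => //.
(* Integration turns the partial sum of length [n] into [Gamma al] times one minus the partial sum
   of length [n.+1]. *)
have -> : [sequence \int[mu]_(x in `]0%R, t[) f n x]_n%E =
    (fun n => (Gamma al * (1 - P n.+1 (- (t `^ ga))))%:E).
  apply/funext => n /=.
  under eq_integral do rewrite fE.
  rewrite integral_sum//; last first.
    by move=> k; apply: integrableZl => //; exact: integrable_KS_kernX.
  rewrite /P /series/= big_nat_recl//= expr0 KS_coef0 mulr1.
  rewrite opprD addrA subrr sub0r -sumrN mulr_sumr -sumEFin; apply: eq_bigr => k _.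
  rewrite integralZl//; last exact: integrable_KS_kernX.
  rewrite integral_KS_kern// -EFinM KS_coefS (exprNn (t `^ ga)) (exprS (-1)); congr EFin.
  by move: ((-1) ^+ k) ((_ `^ _) ^+ k.+1) => e1 e2; ring.
apply: cvg_EFin; first exact: nearW.
apply: cvgMr; apply: cvgB; first exact: cvg_cst.
have := cvP t; rewrite -(cvg_shiftS); exact.
Qed.

End KilbasSaigo_series.

(** * Positivity of [w] and a uniform gap below 1 *)

Section KilbasSaigo_bounds.
Context {R : realType}.
Variables al be : R.
Hypotheses (al_gt0 : 0 < al) (al_le1 : al <= 1) (be_ge0 : 0 <= be).
Local Notation mu := (@lebesgue_measure R).
Local Notation ga := (al + be).
Local Notation w := (KS_sol al be).
Local Notation kern := (KS_kern al be).

Let ga_gt0 : 0 < ga. Proof. exact: ltr_wpDr. Qed.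

Let G_gt0 : 0 < Gamma al. Proof. exact: Gamma_gt0. Qed.

Lemma KS_fun_continuous x : 0 < x -> {for x, continuous (KS_fun al be)}.
Proof.
move=> x0; apply/cvgrPdist_lt => e e0.
pose C := KS_major al be (2 * (x + 1)) + 1.
have C0 : 0 < C.
  by rewrite ltr_wpDl// KS_major_ge0// mulr_ge0// addr_ge0// ltW.
near=> y.
have y0 : 0 < y by near: y; exact: lt_nbhsr.
have yx : y < x + 1 by near: y; apply: lt_nbhsl; rewrite ltrDl.
have xy : `|x - y| < e / C.
  by near: y; apply: cvgr_dist_lt; [exact: cvg_id|rewrite divr_gt0].
apply: (@le_lt_trans _ _ (C * `|x - y|)); last by rewrite mulrC -ltr_pdivlMr.
apply: (@le_trans _ _ (KS_major al be (2 * (x + 1)) * `|x - y|)).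
  apply: KS_fun_lipschitz => //.
  - by rewrite lerDr ltW.
  - by rewrite (ltW x0) lerDl ler01.
  - by rewrite (ltW y0) (ltW yx).
by rewrite ler_wpM2r// lerDl.
Unshelve. all: by end_near. Qed.

Lemma KS_sol_continuous t : 0 < t -> {for t, continuous w}.
Proof.
move=> t0; apply: (@continuous_comp _ _ _ (fun t => t `^ ga) (KS_fun al be)).
  apply: differentiable_continuous; apply/derivable1_diffP.
  by have [] := is_derive1_powR ga t0.
by apply: KS_fun_continuous; rewrite powR_gt0.
Qed.

(** The Lipschitz bound at 0, where [KS_fun] equals 1. It keeps a hypothetical first zero of [w]
    away from 0. *)
Lemma KS_sol_near0 : exists2 e, 0 < e & forall t, 0 < t -> t < e -> 0 < w t.
Proof.
pose C := KS_major al be (2 * 1) + 1.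
have C1 : 1 <= C by rewrite lerDr KS_major_ge0// mulr_ge0.
have C0 : 0 < C by exact: lt_le_trans C1.
exists (C^-1 `^ ga^-1); first by rewrite powR_gt0// invr_gt0.
move=> t t0 te.
have tC : t `^ ga < C^-1.
  have := @gt0_ltr_powR _ _ ga_gt0 t (C^-1 `^ ga^-1).
  rewrite !nnegrE (ltW t0) powR_ge0 -powRrM mulVf ?gt_eqF// powRr1 ?invr_ge0 ?(ltW C0)//.
  by apply.
have C1' : C^-1 <= 1 by rewrite invf_le1.
have := @KS_fun_lipschitz R al be al_gt0 be_ge0 1 0 (t `^ ga) (lexx _).
rewrite lexx ler01 powR_ge0 (le_trans (ltW tC) C1') => /(_ erefl erefl).
rewrite KS_fun0// sub0r normrN (ger0_norm (powR_ge0 _ _)) => h.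
have {}h : 1 - w t < 1.
  rewrite (le_lt_trans (ler_norm _))// (le_lt_trans h)//.
  apply: (@le_lt_trans _ _ (C * t `^ ga)); first by rewrite ler_wpM2r ?powR_ge0// lerDl.
  by rewrite mulrC -ltr_pdivlMr// mul1r.
by move: h; rewrite ltrBlDr ltrDl.
Qed.

(** The Beta value B(1, al), that is 1/al: the integral of (1 - r)^(al - 1) over ]0, 1[. *)
Let Bc : R := Gamma 1 * Gamma al / Gamma (1 + al).

Let Bc_gt0 : 0 < Bc.
Proof. by rewrite divr_gt0 ?mulr_gt0 ?Gamma_gt0 ?addr_gt0. Qed.

Lemma measurable_powR_sub a u (D : set R) : measurable_fun D (fun r : R => (u - r) `^ a).
Proof.
apply: measurable_funTS.
have h : measurable_fun [set: R] (fun r : R => u - r) by exact: measurable_funB.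
exact: (measurableT_comp (@measurable_powR R a) h).
Qed.

Lemma integral_powR_sub s t : s < t ->
  (\int[mu]_(r in `]s, t[) ((t - r) `^ (al - 1))%:E = ((t - s) `^ al * Bc)%:E)%E.
Proof.
move=> st; have ts0 : 0 < t - s by rewrite subr_gt0.
rewrite (@ge0_integral_affine _ 1 s `]s, t[%classic (fun r => ((t - r) `^ (al - 1))%:E)
  ltr01 (measurable_itv _)); last 2 first.
- by apply/measurable_EFinP; exact: measurable_powR_sub.
- by move=> r _; rewrite lee_fin powR_ge0.
rewrite mul1e (_ : _ @^-1` _ = `]0%R, t - s[%classic); last first.
  by apply/seteqP; split=> r /=; rewrite !in_itv/= mul1r ltrDr ltrBrDr.
rewrite EFinM [X in ((t - s) `^ X)%:E](_ : al = 1 + al - 1); last by ring.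
rewrite -Beta_intE// -integral_Beta//.
apply: eq_integral => r _; rewrite mul1r subrr powRr0 mul1r.
by congr ((_ `^ _)%:E); ring.
Qed.

(* Since [al <= 1], for [s < t < u] the ratio of the kernels at [u] and [t] is
   at most its value at [s = 0]. *)
Lemma powR_kernel_ratio s t u : 0 < s -> s < t -> t < u ->
  (u - s) `^ (al - 1) <= (t / u) `^ (1 - al) * (t - s) `^ (al - 1).
Proof.
move=> s0 st tu; have t0 := lt_trans s0 st; have u0 := lt_trans t0 tu.
have ts0 : 0 < t - s by rewrite subr_gt0.
have us0 : 0 < u - s by rewrite subr_gt0 (lt_trans st).
have tu0 : 0 < t / u by rewrite divr_gt0.
have le_ts : t - s <= t / u * (u - s).
  rewrite mulrBr divfK ?gt_eqF// lerD2l lerN2 ler_piMl ?(ltW s0)//.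
  by rewrite ler_pdivrMr// mul1r ltW.
rewrite (_ : al - 1 = - (1 - al)); last by ring.
rewrite !powRN ler_pdivlMr ?powR_gt0// mulrC ler_pdivrMr ?powR_gt0//.
rewrite -powRM ?(ltW tu0) ?(ltW us0)//.
apply: ge0_ler_powR => //; rewrite ?subr_ge0 ?nnegrE ?(ltW ts0)//.
by rewrite mulr_ge0 ?(ltW tu0) ?(ltW us0).
Qed.

Lemma measurable_KS_sol t : measurable_fun (`]0, t[%classic : set R) w.
Proof.
apply: open_continuous_measurable_fun => //.
by move=> x; rewrite inE/= in_itv/= => /andP[x0 _]; exact: KS_sol_continuous.
Qed.

Lemma ge0_integral_split (f : R -> R) s t : 0 < s -> s < t ->
  measurable_fun (`]0, t[%classic : set R) f -> (forall r, 0 < r -> r < t -> 0 <= f r) ->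
  (\int[mu]_(r in `]0%R, t[) (f r)%:E =
   \int[mu]_(r in `]0%R, s[) (f r)%:E + \int[mu]_(r in `]s, t[) (f r)%:E)%E.
Proof.
move=> s0 st mf f0.
have U : `]0, t[%classic = `]0, s[ `|` `[s, t[ :> set R.
  apply/seteqP; split=> r /=; rewrite !in_itv/=.
    by move=> /andP[r0 rt]; rewrite r0 rt; case: (ltP r s) => _; [left|right].
  by case=> /andP[r1 r2]; rewrite ?(lt_trans r2 st) ?r1 ?(lt_le_trans s0 r1).
rewrite [X in (_ + X)%E]integral_itv_obnd_cbnd; last first.
  apply/measurable_EFinP; apply: measurable_funS mf => // r /=; rewrite !in_itv/=.
  by move=> /andP[/(lt_trans s0) -> ->].
rewrite U ge0_integral_setU//=.
- by rewrite -U; apply/measurable_EFinP.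
- move=> r; rewrite -[_ \/ _]/((`]0, s[ `|` `[s, t[)%classic r) -U /= in_itv/= => /andP[r0 rt].
  by rewrite lee_fin f0.
- apply/disj_setPS => r /=; rewrite !in_itv/= => -[/andP[_ rs] /andP[sr _]].
  by have := le_lt_trans sr rs; rewrite ltxx.
Qed.

Lemma measurable_kern_sol u t : measurable_fun (`]0, t[%classic : set R) (fun s => kern u s * w s).
Proof. by apply: measurable_funM; [exact: measurable_KS_kern|exact: measurable_KS_sol]. Qed.

(* At a first zero [u], compare the Volterra equations at [u] and at the point
   [c < u] where the solution is maximal on some short interval [t1, u]: the
   integral over [0, c] drops by the factor [rh], and the rest is at most
   [kap c < rh] times the maximum, so the integral cannot reach the value it
   has to take at [u]. *)
Lemma KS_sol_gt0 t : 0 < t -> 0 < w t.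
Proof.
have half (a b : R) : b <= a / 2 -> a / 2 <= a - b by lra.
move=> t_gt0; rewrite ltNge; apply/negP => wt.
have [e e0 we] := KS_sol_near0.
pose S : set R := [set s | 0 < s /\ w s <= 0].
have lbS : lbound S e.
  move=> s [s0 ws]; rewrite leNgt; apply/negP => se.
  by have := we _ s0 se; rewrite ltNge ws.
have St : S t by [].
have infS : has_inf S by split; [exists t|exists e].
pose u := inf S.
have u0 : 0 < u by rewrite (lt_le_trans e0)// lb_le_inf//; exists t.
have w_lt s : 0 < s -> s < u -> 0 < w s.
  move=> s0 su; rewrite ltNge; apply/negP => ws.
  by have := ge_inf infS.2 (conj s0 ws : S s); rewrite leNgt su.
have wu : w u <= 0.
  rewrite leNgt; apply/negP => wu.
  have : \forall s \near u, 0 < w s.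
    by have /cvgr_gt := KS_sol_continuous _ u0; apply.
  move=> /nbhs_ballP[d /= d0 hd].
  have [s [s0 ws] sd] := inf_adherent d0 infS.
  have us : u <= s by exact: (ge_inf infS.2 (conj s0 ws : S s)).
  have : 0 < w s by apply: hd; rewrite /ball/= distrC ger0_norm ?subr_ge0// ltrBlDr addrC.
  by rewrite ltNge ws.
(* [kap s] bounds the mass of [kern u] on ]s, u[, divided by [Gamma al]. *)
pose kap s := u `^ be * (u - s) `^ al * Bc / Gamma al.
have [t1 /andP[t10 t1u] t1k] : exists2 s, 0 < s < u & kap s < (s / u) `^ (1 - al).
  pose D := u `^ be * Bc / Gamma al.
  have D0 : 0 < D by rewrite divr_gt0// mulr_gt0// powR_gt0.
  (* With this [d], [kap (u - d)] is at most 1/4, while the ratio (u - d)/u, and hence its power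
     [1 - al], is at least 1/2. *)
  pose d := Num.min (u / 2) ((4 * D)^-1 `^ al^-1).
  have D40 : 0 < (4 * D)^-1 by rewrite invr_gt0 mulr_gt0.
  have d0 : 0 < d by rewrite lt_min divr_gt0//= powR_gt0.
  have du : d <= u / 2 by rewrite ge_min lexx.
  have dD : d `^ al <= (4 * D)^-1.
    rewrite [leRHS](_ : _ = ((4 * D)^-1 `^ al^-1) `^ al); last first.
      by rewrite -powRrM mulVf ?lt0r_neq0// powRr1// ltW.
    apply: ge0_ler_powR; rewrite ?nnegrE ?powR_ge0 ?(ltW d0) ?(ltW al_gt0)//.
    by rewrite /d ge_min lexx orbT.
  have ud : u / 2 <= u - d := half _ _ du.
  have ud0 : 0 < u - d by rewrite (lt_le_trans _ ud)// divr_gt0.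
  exists (u - d); first by rewrite ud0 ltrBlDr ltrDl.
  apply: (@le_lt_trans _ _ (4^-1)).
    rewrite /kap (_ : u - (u - d) = d); last by ring.
    rewrite (_ : _ / _ = D * d `^ al); last by rewrite /D; ring.
    by rewrite -ler_pdivlMl// -invfM mulrC.
  have h : 2^-1 <= (u - d) / u by rewrite ler_pdivlMr// mulrC.
  apply: (@lt_le_trans _ _ 2^-1); first by rewrite ltf_pV2 ?posrE// ltr_nat.
  rewrite (le_trans h)//; apply: ger1_powR; last by rewrite gerBl ltW.
  by rewrite divr_gt0//= ler_pdivrMr// mul1r gerBl ltW.
have [c /[!in_itv]/= /andP[t1c cu] cmax] : exists2 c, c \in `[t1, u] & forall s, s \in `[t1, u] -> w s <= w c.
  apply: EVT_max; first exact: ltW.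
  apply: continuous_in_subspaceT => s /set_mem/=; rewrite in_itv/= => /andP[t1s _].
  by apply: KS_sol_continuous; exact: lt_le_trans t1s.
have wc : 0 < w c.
  by rewrite (lt_le_trans (w_lt _ t10 t1u))// cmax// in_itv/= lexx ltW.
have {}cu : c < u.
  by rewrite lt_neqAle cu andbT; apply: contraTneq wc => ->; rewrite -leNgt.
have c0 : 0 < c by exact: lt_le_trans t1c.
pose rh := (c / u) `^ (1 - al).
have al1_ge0 : 0 <= 1 - al by rewrite subr_ge0.
have cu0 : 0 < c / u by rewrite divr_gt0.
have rh1 : rh <= 1.
  rewrite /rh -[leRHS](powRr0 (c / u)); apply: ger_powR => //.
  by rewrite cu0 ler_pdivrMr// mul1r ltW.
have kc : kap c < rh.
  apply: (@le_lt_trans _ _ (kap t1)).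
    rewrite /kap ler_pM2r ?invr_gt0// ler_pM2r// ler_pM2l ?powR_gt0//.
    apply: ge0_ler_powR; rewrite ?nnegrE ?subr_ge0 ?(ltW al_gt0) ?(ltW cu) ?(ltW t1u)//.
    by rewrite lerD2l lerN2.
  rewrite (lt_le_trans t1k)//; apply: ge0_ler_powR => //.
  - by rewrite nnegrE divr_ge0// ltW.
  - by rewrite nnegrE ltW.
  - by rewrite ler_pM2r// invr_gt0.
have kw0 v r : 0 < r -> r < u -> 0 <= kern v r * w r.
  by move=> r0 ru; exact: mulr_ge0 (KS_kern_ge0 _ _ _ _) (ltW (w_lt r r0 ru)).
have key : Gamma al * (1 - w u) <= rh * (Gamma al * (1 - w c)) + w c * (Gamma al * kap c).
  have [_ Vu] := KS_volterra al be al_gt0 be_ge0 u u0.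
  have [_ Vc] := KS_volterra al be al_gt0 be_ge0 c c0.
  rewrite -lee_fin EFinD (EFinM rh (Gamma al * _)) -Vu -Vc.
  rewrite (@ge0_integral_split (fun s => kern u s * w s) c u c0 cu); last 2 first.
  - exact: measurable_kern_sol.
  - exact: kw0.
  apply: leeD.
    rewrite -ge0_integralZl//=.
    - apply: ge0_le_integral => //=.
      + move=> s; rewrite in_itv/= => /andP[s0 sc].
        by rewrite lee_fin; exact: kw0 (lt_trans sc cu).
      + by apply/measurable_EFinP; exact: measurable_kern_sol.
      + apply: emeasurable_funM => //; apply/measurable_EFinP; exact: measurable_kern_sol.
      + move=> s; rewrite in_itv/= => /andP[s0 sc]; rewrite -EFinM lee_fin mulrA.
        apply: ler_wpM2r; first exact: ltW (w_lt s s0 (lt_trans sc cu)).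
        by rewrite /KS_kern [leRHS]mulrCA ler_wpM2l ?powR_ge0// powR_kernel_ratio.
    - by apply/measurable_EFinP; exact: measurable_kern_sol.
    - move=> s; rewrite in_itv/= => /andP[s0 sc].
      by rewrite lee_fin; exact: kw0 (lt_trans sc cu).
    - by rewrite lee_fin powR_ge0.
  rewrite (_ : Gamma al * kap c = u `^ be * ((u - c) `^ al * Bc)); last first.
    by rewrite /kap; field; rewrite gt_eqF.
  rewrite mulrA [leRHS]EFinM -integral_powR_sub// -ge0_integralZl//=.
  - apply: ge0_le_integral => //=.
    + move=> s; rewrite in_itv/= => /andP[cs su].
      by rewrite lee_fin; exact: kw0 (lt_trans c0 cs) su.
    + apply/measurable_EFinP; apply: measurable_funS (measurable_kern_sol u u) => // s /=.
      by rewrite !in_itv/= => /andP[/(lt_trans c0) -> ->].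
    + apply/measurable_EFinP; apply: measurable_funM => //; exact: measurable_powR_sub.
    + move=> s; rewrite in_itv/= => /andP[cs su]; have s0 := lt_trans c0 cs.
      rewrite lee_fin /KS_kern [leLHS]mulrC mulrA; apply: ler_wpM2r; first exact: powR_ge0.
      apply: ler_pM; [exact: ltW (w_lt s s0 su)|exact: powR_ge0| |].
        by apply: cmax; rewrite in_itv/= (le_trans t1c (ltW cs)) ltW.
      by apply: ge0_ler_powR => //; rewrite ?nnegrE ltW.
  - by apply/measurable_EFinP; exact: measurable_powR_sub.
  - by move=> s _; rewrite lee_fin powR_ge0.
  - by rewrite lee_fin mulr_ge0 ?powR_ge0// ltW.
(* As [w u <= 0], the left side of [key] is at least [Gamma al]. The right side is [Gamma al] times
   [rh - w c * (rh - kap c)], which is below [rh <= 1]: a contradiction. *)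
have : 1 <= rh * (1 - w c) + w c * kap c.
  rewrite -(ler_pM2l G_gt0) mulr1 (le_trans _ (le_trans key _))//.
    by rewrite ler_peMr ?(ltW G_gt0)// lerDl oppr_ge0.
  by rewrite le_eqVlt; apply/orP; left; apply/eqP; ring.
apply/negP; rewrite -ltNge (_ : _ + _ = rh - w c * (rh - kap c)); last by ring.
by rewrite (lt_le_trans _ rh1)// ltrBlDr ltrDl mulr_gt0// subr_gt0.
Qed.

Lemma kern_sol_ge0 v r : 0 < r -> 0 <= kern v r * w r.
Proof. by move=> r0; exact: mulr_ge0 (KS_kern_ge0 _ _ _ _) (ltW (KS_sol_gt0 r r0)). Qed.

Lemma KS_sol_le1 t : 0 < t -> w t <= 1.
Proof.
move=> t0; have [_ V] := KS_volterra al be al_gt0 be_ge0 t t0.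
rewrite -subr_ge0 -(pmulr_rge0 _ G_gt0) -lee_fin -V.
apply: integral_ge0 => s /=; rewrite in_itv/= => /andP[s0 _].
by rewrite lee_fin; exact: kern_sol_ge0.
Qed.

(** The kernel decreases when its first argument grows from [s] to [t], and [w <= 1]; so the
    integral over ]0, s[ loses at most t^be times the loss of mass of (s - r)^(al - 1), which is at
    most Bc (t - s)^al. The bound is one-sided: [w] cannot rise fast, so a large value at [t] forces
    large values just before [t]. *)
Lemma KS_sol_modulus s t : 0 < s -> s < t ->
  Gamma al * (1 - w s) <= Gamma al * (1 - w t) + t `^ be * Bc * (t - s) `^ al.
Proof.
move=> s0 st; have t0 := lt_trans s0 st.
have [_ Vs] := KS_volterra al be al_gt0 be_ge0 s s0.
have [_ Vt] := KS_volterra al be al_gt0 be_ge0 t t0.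
have kw0 u r : 0 < r -> 0 <= kern u r * w r.
  exact: kern_sol_ge0.
pose k u r : R := (u - r) `^ (al - 1).
have mk u (D : set R) : measurable_fun D (k u) by exact: measurable_powR_sub.
have ks : (\int[mu]_(r in `]0%R, s[) (k s r)%:E = (s `^ al * Bc)%:E)%E.
  by rewrite integral_powR_sub// subr0.
have kt : (\int[mu]_(r in `]0%R, s[) (k t r)%:E = ((t `^ al - (t - s) `^ al) * Bc)%:E)%E.
  have : (\int[mu]_(r in `]0%R, t[) (k t r)%:E = (t `^ al * Bc)%:E)%E.
    by rewrite integral_powR_sub// subr0.
  rewrite (@ge0_integral_split (k t) s t s0 st); last 2 first.
  - exact: mk.
  - by move=> r _ _; exact: powR_ge0.
  rewrite (integral_powR_sub _ _ st).
  (* The integral over ]0, s[ is part of a finite total, so its real value can be solved for. *)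
  case: (\int[mu]_(r in `]0%R, s[) (k t r)%:E)%E => [x [/eqP]| |] //.
  by rewrite eq_sym -subr_eq -mulrBl => /eqP <-.
pose T := t `^ be; have T0 : 0 < T by rewrite powR_gt0.
(* Both differences are moved across the inequality so that all integrands are nonnegative;
   pointwise it says (k s r - k t r)(T - r^be w r) >= 0. *)
have le1 : (\int[mu]_(r in `]0%R, s[) (kern s r * w r)%:E +
    \int[mu]_(r in `]0%R, s[) (T%:E * (k t r)%:E) <=
    \int[mu]_(r in `]0%R, s[) (kern t r * w r)%:E +
    \int[mu]_(r in `]0%R, s[) (T%:E * (k s r)%:E))%E.
  have mkw u : measurable_fun (`]0, s[%classic : set R) (fun r => (kern u r * w r)%:E).
    by apply/measurable_EFinP; exact: measurable_kern_sol.
  have mTk u : measurable_fun (`]0, s[%classic : set R) (fun r => (T%:E * (k u r)%:E)%E).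
    by apply/measurable_EFinP; apply: measurable_funM => //; exact: mk.
  have Tk0 u r : (0 <= T%:E * (k u r)%:E)%E by rewrite -EFinM lee_fin mulr_ge0 ?powR_ge0.
  have kw0' u (r : R) : `]0, s[%classic r -> (0 <= (kern u r * w r)%:E)%E.
    by rewrite /= in_itv/= => /andP[r0 _]; rewrite lee_fin kw0.
  have intD u v : (\int[mu]_(r in `]0%R, s[) (kern u r * w r)%:E +
      \int[mu]_(r in `]0%R, s[) (T%:E * (k v r)%:E) =
      \int[mu]_(r in `]0%R, s[) ((kern u r * w r)%:E + T%:E * (k v r)%:E))%E.
    exact/esym/(@ge0_integralD _ _ R mu _ (measurable_itv _) _ _ (kw0' u) (mkw u) (fun r _ => Tk0 v r) (mTk v)).
  rewrite !intD.
  apply: ge0_le_integral => //=.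
  - by move=> r hr; rewrite adde_ge0// kw0'.
  - by apply: emeasurable_funD; [exact: mkw|exact: mTk].
  - by apply: emeasurable_funD; [exact: mkw|exact: mTk].
  - move=> r; rewrite in_itv/= => /andP[r0 rs].
    rewrite -!EFinM -!EFinD lee_fin /KS_kern -/(k s r) -/(k t r).
    rewrite -subr_ge0 (_ : _ - _ = (k s r - k t r) * (T - r `^ be * w r)); last by ring.
    rewrite mulr_ge0// subr_ge0.
      rewrite /k (_ : al - 1 = - (1 - al)); last by ring.
      have rs' : 0 < s - r by rewrite subr_gt0.
      have rt' : 0 < t - r by rewrite subr_gt0 (lt_trans rs).
      rewrite !powRN lef_pV2 ?posrE ?powR_gt0//.
      apply: ge0_ler_powR; rewrite ?nnegrE ?subr_ge0 ?(ltW rs) ?(ltW (lt_trans rs st))//.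
      by rewrite lerD2r ltW.
    apply: (@le_trans _ _ (r `^ be)); first by rewrite ler_piMr ?powR_ge0// KS_sol_le1.
    by apply: ge0_ler_powR => //; rewrite ?nnegrE ltW// (lt_trans rs).
have le2 : (\int[mu]_(r in `]0%R, s[) (kern t r * w r)%:E <= (Gamma al * (1 - w t))%:E)%E.
  rewrite -Vt; apply: ge0_subset_integral => //=.
  - by apply/measurable_EFinP; exact: measurable_kern_sol.
  - by move=> r; rewrite in_itv/= => /andP[r0 _]; rewrite lee_fin kw0.
  - by move=> r; rewrite /= !in_itv/= => /andP[-> /lt_trans ->].
have := le_trans le1 (leeD2r _ le2).
have intZ u : (\int[mu]_(r in `]0%R, s[) (T%:E * (k u r)%:E) =
    T%:E * \int[mu]_(r in `]0%R, s[) (k u r)%:E)%E.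
  apply: (@ge0_integralZl _ _ R mu _ (measurable_itv _) (EFin \o k u)).
  - by apply/measurable_EFinP; exact: mk.
  - by move=> r _; rewrite lee_fin powR_ge0.
  - by rewrite lee_fin ltW.
rewrite Vs !intZ ks kt -!EFinM -!EFinD lee_fin => h.
have st_al : s `^ al <= t `^ al by apply: ge0_ler_powR; rewrite ?nnegrE ltW.
have : 0 <= T * Bc * (t `^ al - s `^ al).
  by apply: mulr_ge0; [exact: ltW (mulr_gt0 T0 Bc_gt0)|rewrite subr_ge0].
move: h; rewrite -/T; lra.
Qed.

(** Either [w t <= 1/2], or the modulus keeps [w] above 1/4 on an interval of length [h] before [t],
    whose share of the Volterra integral bounds [1 - w t] from below. Since h^al is proportional to
    t^(-be) and the kernel carries t^be, the bound does not depend on [t]. *)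
Lemma KS_sol_gap t1 : 0 < t1 ->
  exists2 c, 0 < c & forall t, t1 <= t -> c <= 1 - w t.
Proof.
have arith (x y z : R) : 1 - x <= 1 - y + z -> 2^-1 < y -> z <= 4^-1 -> 4^-1 <= x by lra.
move=> t10.
(* The entry 1/4 limits the drop of [w]; the other entry forces [h <= t1 / 2], hence
   [t - h >= t / 2]. *)
pose q := Num.min (4^-1) (t1 `^ be * Bc * (t1 / 2) `^ al / Gamma al).
have q0 : 0 < q.
  have t12 : 0 < t1 / 2 by rewrite divr_gt0.
  rewrite lt_min invr_gt0 ltr0n/=; apply: divr_gt0 => //.
  by apply: mulr_gt0; [apply: mulr_gt0 => //|]; exact: powR_gt0.
have q4 : q <= 4^-1 by rewrite ge_min lexx.
have h20 : 0 < 2^-1 `^ be :> R by rewrite powR_gt0.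
have h21 : 2^-1 `^ be <= 1 :> R.
  rewrite -[leRHS](powRr0 2^-1); apply: ger_powR => //.
  by rewrite invr_gt0 ltr0n/= invf_le1 ?ler1n.
exists (2^-1 `^ be * q * 4^-1); first by rewrite !mulr_gt0.
move=> t t1t; have t0 : 0 < t := lt_le_trans t10 t1t.
have bound : 2^-1 `^ be * q * 4^-1 <= 2^-1.
  have : 2^-1 `^ be * q <= 1 * 4^-1 by apply: ler_pM => //; rewrite ltW.
  lra.
have [wt|wt] := leP (w t) 2^-1; first by lra.
(* Chosen so that the modulus term t^be Bc h^al equals [q * Gamma al]. *)
pose h := (q * Gamma al / (t `^ be * Bc)) `^ al^-1.
have D0 : 0 < t `^ be * Bc by apply: mulr_gt0 => //; exact: powR_gt0.
have Q0 : 0 < q * Gamma al / (t `^ be * Bc).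
  by apply: divr_gt0 => //; exact: mulr_gt0.
have h0 : 0 < h by rewrite powR_gt0.
have hal : h `^ al = q * Gamma al / (t `^ be * Bc).
  by rewrite /h -powRrM mulVf ?lt0r_neq0// powRr1// ltW.
have tbe : t1 `^ be <= t `^ be by apply: ge0_ler_powR; rewrite ?nnegrE ?(ltW t0) ?(ltW t10).
have ht2 : h <= t1 / 2.
  have t12 : 0 < t1 / 2 by rewrite divr_gt0.
  rewrite leNgt; apply/negP => ht.
  have : (t1 / 2) `^ al < h `^ al by apply: gt0_ltr_powR => //; rewrite nnegrE ltW.
  apply/negP; rewrite -leNgt hal ler_pdivrMr//.
  rewrite -ler_pdivlMr//; apply: (@le_trans _ _ (t1 `^ be * Bc * (t1 / 2) `^ al / Gamma al)).
    by rewrite ge_min lexx orbT.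
  rewrite ler_pM2r ?invr_gt0// [leRHS]mulrC ler_pM2r ?powR_gt0//.
  by rewrite ler_pM2r.
have th2 : t / 2 <= t - h.
  rewrite lerBrDr -lerBrDl (le_trans ht2)// lerBrDr -mulrDl ler_pdivrMr// mulr_natr mulr2n.
  by rewrite lerD2r.
have th0 : 0 < t - h by rewrite (lt_le_trans _ th2)// divr_gt0.
have tht : t - h < t by rewrite gtrBl.
have [_ Vt] := KS_volterra al be al_gt0 be_ge0 t t0.
have low r : t - h < r -> r < t -> 4^-1 <= w r.
  move=> r1 r2; have r0 := lt_trans th0 r1.
  have := KS_sol_modulus r t r0 r2.
  have : (t - r) `^ al <= h `^ al.
    apply: ge0_ler_powR; rewrite ?nnegrE ?subr_ge0 ?(ltW al_gt0) ?(ltW h0) ?(ltW r2)//.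
    by rewrite lerBlDr -lerBlDl ltW.
  rewrite hal ler_pdivlMr// => hr.
  rewrite [X in _ <= _ + X]mulrC -/Bc => hm.
  have := le_trans hm (lerD (lexx _) hr).
  by rewrite [q * _]mulrC -mulrDr ler_pM2l// => /arith; apply.
have : Gamma al * (2^-1 `^ be * q * 4^-1) <= Gamma al * (1 - w t); last by rewrite ler_pM2l.
rewrite -lee_fin -Vt (@ge0_integral_split (fun s => kern t s * w s) (t - h) t th0 tht); last 2 first.
- exact: measurable_kern_sol.
- by move=> r r0 _; exact: kern_sol_ge0.
apply: lee_paddl.
  apply: integral_ge0 => r /=; rewrite in_itv/= => /andP[r0 _].
  by rewrite lee_fin; exact: kern_sol_ge0.
(* A lower bound for r^be w(r) on ]t - h, t[. *)
pose A := (t / 2) `^ be * 4^-1.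
have A0 : 0 <= A by rewrite mulr_ge0 ?powR_ge0.
apply: (@le_trans _ _ (\int[mu]_(r in `](t - h)%R, t[) (A%:E * ((t - r) `^ (al - 1))%:E))%E).
  rewrite ge0_integralZl//=.
  - rewrite integral_powR_sub// -EFinM lee_fin (_ : t - (t - h) = h); last by ring.
    rewrite -/Bc hal /A powRM ?invr_ge0 ?(ltW t0)//.
    rewrite le_eqVlt; apply/orP; left; apply/eqP; field.
    by rewrite !lt0r_neq0// powR_gt0.
  - by apply/measurable_EFinP; exact: measurable_powR_sub.
  - by move=> r _; rewrite lee_fin powR_ge0.
apply: ge0_le_integral => //=.
- by move=> r _; rewrite -EFinM lee_fin mulr_ge0 ?powR_ge0.
- by apply/measurable_EFinP; apply: measurable_funM => //; exact: measurable_powR_sub.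
- apply/measurable_EFinP; apply: measurable_funS (measurable_kern_sol t t) => // r /=.
  by rewrite !in_itv/= => /andP[/(lt_trans th0) -> ->].
move=> r; rewrite in_itv/= => /andP[r1 r2]; have r0 := lt_trans th0 r1.
rewrite -EFinM lee_fin /KS_kern /A [leRHS]mulrAC; apply: ler_wpM2r; first exact: powR_ge0.
apply: ler_pM; rewrite ?powR_ge0//; last exact: low.
by apply: ge0_ler_powR => //; rewrite ?nnegrE; lra.
Qed.

End KilbasSaigo_bounds.

(** * Two-sided bounds for the singular values *)

Section sigma_bounds.
Context {R : realType}.
Variables al be : R.
Hypotheses (al_gt0 : 0 < al) (al_le1 : al <= 1) (be_ge0 : 0 <= be).
Local Notation ga := (al + be).

Let ga_gt0 : 0 < ga. Proof. exact: ltr_wpDr. Qed.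

Lemma eta2_KS_ratio : eta2 al be = KS_ratio al be 1.
Proof. by rewrite /eta2 /KS_ratio; congr (Gamma _ / Gamma _); ring. Qed.

(** The Gamma quotients on the left are [KS_ratio] from index 2 on, and [eta2] is the ratio of index
    1; multiplying by [eta2 * x] restores the series of [KS_fun] without its constant term and with
    opposite sign. *)
Lemma KilbasSaigo_KS_fun x : 0 < x ->
  eta2 al be * x * KilbasSaigo al (1 + be / al) (1 + 2 * be / al) (- x) =
  1 - KS_fun al be x.
Proof.
move=> x0; have e0 : 0 < eta2 al be by rewrite eta2_KS_ratio KS_ratio_gt0.
have coefE k : \prod_(0 <= j < k)
    (Gamma (al * (j%:R * (1 + be / al) + (1 + 2 * be / al)) + 1) /
     Gamma (al * (j%:R * (1 + be / al) + (1 + 2 * be / al) + 1) + 1)) =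
    KS_coef al be k.+1 / eta2 al be.
  rewrite /KS_coef big_nat_recl// -eta2_KS_ratio [RHS]mulrAC divff ?gt_eqF// mul1r.
  apply: eq_bigr => j _; rewrite /KS_ratio -!natr1.
  by congr (Gamma _ / Gamma _); field; rewrite gt_eqF.
pose S n := series (fun k => KS_coef al be k * (- x) ^+ k) n.
have cS : S n @[n --> \oo] --> KS_fun al be x by apply: KS_fun_cvg => //; exact: ltW.
rewrite /KilbasSaigo mulrDr mulr1.
rewrite (_ : limn _ = (1 - KS_fun al be x) / (eta2 al be * x) - 1).
  by field; rewrite !gt_eqF.
apply/cvg_lim => //.
have : (1 - S n.+1) / (eta2 al be * x) - 1 @[n --> \oo] -->
    (1 - KS_fun al be x) / (eta2 al be * x) - 1.
  apply: cvgB; last exact: cvg_cst.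
  apply: cvgM; last exact: cvg_cst.
  apply: cvgB; first exact: cvg_cst.
  by have := cS; rewrite -(cvg_shiftS).
(* The partial sums agree from [n = 1] on only: for [n = 0] the term that matches the constant 1 of
   [KilbasSaigo] is missing. *)
apply: cvg_trans; apply: near_eq_cvg; exists 1%N => // n /= n1.
rewrite /S /series/= big_nat_recl// KS_coef0 expr0 mulr1 big_ltn//.
rewrite KS_coefS KS_coef0 mul1r -eta2_KS_ratio expr1.
under [in RHS]eq_bigr do rewrite coefE.
rewrite (_ : \sum_(1 <= i < n) KS_coef al be i.+1 * (- x) ^+ i.+1 = - (eta2 al be * x) *
    \sum_(1 <= k < n) KS_coef al be k.+1 / eta2 al be * (- x) ^+ k); last first.
  rewrite mulr_sumr; apply: eq_bigr => k _; rewrite exprS.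
  by field; rewrite gt_eqF.
by field; rewrite !gt_eqF.
Qed.

Lemma sigma_KS_fun (l : R) (lambda : nat -> R) k : 0 < l -> 0 < lambda k ->
  sigma al be l lambda k =
  (1 - KS_fun al be (Num.sqrt (lambda k) * l `^ ga)) / lambda k.
Proof.
move=> l0 lk0; have s0 : 0 < Num.sqrt (lambda k) by rewrite sqrtr_gt0.
rewrite -KilbasSaigo_KS_fun ?mulr_gt0 ?powR_gt0// /sigma.
move: (Num.sqrt (lambda k)) s0 (sqr_sqrtr (ltW lk0)) => s s0 <-.
by field; rewrite gt_eqF.
Qed.

(** Every [t k] is at least [t 0], so the gap of [w] on the half-line from [t 0] gives one constant
    for all [k]. The upper bound is positivity of [w]. *)
Lemma sigma_bounds (l : R) (lambda : nat -> R) : 0 < l ->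
  0 < lambda 0 -> (forall k, lambda 0 <= lambda k) ->
  exists2 c, 0 < c & forall k, c / lambda k <= sigma al be l lambda k <= (lambda k)^-1.
Proof.
move=> l0 l00 l0k.
pose t k := Num.sqrt (lambda k) `^ ga^-1 * l.
have lk0 k : 0 < lambda k by exact: lt_le_trans (l0k k).
have sk0 k : 0 < Num.sqrt (lambda k) by rewrite sqrtr_gt0.
have t0 k : 0 < t k by rewrite mulr_gt0// powR_gt0.
have [c c0 hc] := KS_sol_gap al be al_gt0 al_le1 be_ge0 (t 0%N) (t0 0%N).
exists c => // k.
have tE : KS_sol al be (t k) = KS_fun al be (Num.sqrt (lambda k) * l `^ ga).
  rewrite /KS_sol /t powRM ?powR_ge0 ?(ltW l0)// -powRrM mulVf ?lt0r_neq0//.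
  by rewrite powRr1// ltW.
rewrite sigma_KS_fun// -tE ler_pM2r ?invr_gt0// hc/=; last first.
  rewrite /t ler_pM2r//; apply: ge0_ler_powR; rewrite ?nnegrE ?invr_ge0 ?(ltW ga_gt0) ?sqrtr_ge0//.
  by rewrite ler_wsqrtr.
by rewrite ler_pdivrMr// mulVf ?gt_eqF// gerBl ltW// KS_sol_gt0.
Qed.

End sigma_bounds.

(** * Fourier coefficients in [L^2] *)

Section L2_theory.
Context {R : realType} {N : nat}.
Variable Omega : set 'rV[R]_N.
Hypothesis Omega_open : open Omega.
Local Notation mu := (@lebesgueRV R N).
Implicit Types f g h u : 'rV[R]_N -> R.

Let mO : measurable (Omega : set (borelRV R N)).
Proof. exact: borelRV_open. Qed.

Lemma inL2_mul_integrable f g : inL2 Omega f -> inL2 Omega g ->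
  mu.-integrable Omega (fun x : borelRV R N => (f x * g x)%:E).
Proof.
move=> [mf f2] [mg g2].
apply: (le_integrable mO _ _ (integrableD mO f2 g2)).
  by apply/measurable_EFinP; exact: measurable_funM.
move=> x _; rewrite -EFinD /= !lee_fin (ger0_norm (addr_ge0 (sqr_ge0 _) (sqr_ge0 _))).
have := sqr_ge0 (`|f x| - `|g x|); rewrite normrM -(real_normK (num_real (f x))) -(real_normK (num_real (g x))).
have := normr_ge0 (f x); have := normr_ge0 (g x); nra.
Qed.

Lemma inL2_lin f g a : inL2 Omega f -> inL2 Omega g ->
  inL2 Omega (fun x => f x + a * g x).
Proof.
move=> Hf Hg; have fg := inL2_mul_integrable _ _ Hf Hg.
have [mf f2] := Hf; have [mg g2] := Hg.
have mfg : measurable_fun (Omega : set (borelRV R N)) (fun x : borelRV R N => f x + a * g x).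
  by apply: measurable_funD => //; apply: measurable_funM.
split => //.
have i1 := integrableD mO f2 (integrableD mO (integrableZl mO (2 * a) fg) (integrableZl mO (a ^+ 2) g2)).
apply: (eq_integrable mO _ _ _ i1) => x _ /=.
by rewrite -!EFinM -!EFinD; congr EFin; ring.
Qed.

Lemma inL2_0 : inL2 Omega (fun=> 0).
Proof.
split; first exact: measurable_cst.
rewrite (_ : (fun x => _) = cst 0%E); first exact: integrable0.
by apply/funext => x; rewrite expr0n.
Qed.

Lemma inL2_sub f g : inL2 Omega f -> inL2 Omega g -> inL2 Omega (fun x => f x - g x).
Proof.
move=> Hf Hg; rewrite (_ : (fun x => _) = (fun x => f x + (-1) * g x)); first exact: inL2_lin.
by apply/funext => x; rewrite mulN1r.
Qed.

Lemma L2innerC f g : L2inner Omega f g = L2inner Omega g f.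
Proof. by apply: eq_Rintegral => x _; rewrite mulrC. Qed.

Lemma L2inner_linl f g h a : inL2 Omega f -> inL2 Omega g -> inL2 Omega h ->
  L2inner Omega (fun x => f x + a * g x) h = L2inner Omega f h + a * L2inner Omega g h.
Proof.
move=> Hf Hg Hh.
have fh := inL2_mul_integrable _ _ Hf Hh; have gh := inL2_mul_integrable _ _ Hg Hh.
rewrite /L2inner -RintegralZl//.
rewrite -RintegralD//; last first.
  by apply: (eq_integrable mO _ _ _ (integrableZl mO a gh)).
by apply: eq_Rintegral => x _; ring.
Qed.

Lemma L2inner_subl f g h : inL2 Omega f -> inL2 Omega g -> inL2 Omega h ->
  L2inner Omega (fun x => f x - g x) h = L2inner Omega f h - L2inner Omega g h.
Proof.
move=> Hf Hg Hh; rewrite -mulN1r -L2inner_linl//.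
by apply: eq_Rintegral => x _; ring.
Qed.

Lemma L2inner0l h : L2inner Omega (fun=> 0) h = 0.
Proof. by rewrite /L2inner /Rintegral integral0_eq// => x _; rewrite mul0r. Qed.

Lemma L2inner_sq_lin f g a : inL2 Omega f -> inL2 Omega g ->
  let u x := f x + a * g x in
  L2inner Omega u u = L2inner Omega f f + 2 * a * L2inner Omega f g + a ^+ 2 * L2inner Omega g g.
Proof.
move=> Hf Hg u; have Hu : inL2 Omega u by exact: inL2_lin.
rewrite {1}/u L2inner_linl// (L2innerC f u) (L2innerC g u) !L2inner_linl//.
rewrite (L2innerC g f); ring.
Qed.

Lemma L2inner_ge0 f : 0 <= L2inner Omega f f.
Proof. by apply: Rintegral_ge0 => x _; rewrite -expr2 sqr_ge0. Qed.

Lemma L2norm_sqr f : L2norm Omega f ^+ 2 = L2inner Omega f f.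
Proof. by rewrite sqr_sqrtr// L2inner_ge0. Qed.

Section basis.
Variable phi : nat -> 'rV[R]_N -> R.
Hypothesis phi_basis : complete_orthonormal_basis Omega phi.
Local Notation coef f k := (L2inner Omega f (phi k)).

Let phi_L2 k : inL2 Omega (phi k). Proof. by case: phi_basis. Qed.

Let phi_orth j k : L2inner Omega (phi j) (phi k) = (j == k)%:R.
Proof. by case: phi_basis. Qed.

Let err (c : nat -> R) f n x := \sum_(0 <= k < n) c k * phi k x - f x.

Let err0 c f : err c f 0 = (fun x => 0 - f x).
Proof. by apply/funext => x; rewrite /err big_geq. Qed.

Let errS c f n : err c f n.+1 = (fun x => err c f n x + c n * phi n x).
Proof. by apply/funext => x; rewrite /err big_nat_recr//=; ring. Qed.

Let err_L2 c f n : inL2 Omega f -> inL2 Omega (err c f n).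
Proof.
move=> Hf; elim: n => [|n ih]; first by rewrite err0; apply: inL2_sub => //; exact: inL2_0.
by rewrite errS; exact: inL2_lin.
Qed.

Let err_coef c f n j : inL2 Omega f ->
  coef (err c f n) j = (if (j < n)%N then c j else 0) - coef f j.
Proof.
move=> Hf; elim: n => [|n ih].
  by rewrite err0 L2inner_subl// ?L2inner0l//; exact: inL2_0.
rewrite errS L2inner_linl//; last exact: err_L2.
rewrite ih phi_orth ltnS (leq_eqVlt j n).
have [<-|nj] := eqVneq j n; first by rewrite ltnn/= mulr1 addrAC add0r.
by rewrite mulr0 addr0.
Qed.

(** Bessel's inequality with one term: the square norm of [u] minus its projection on [phi j] is
    nonnegative. *)
Lemma coef_le_L2norm u j : inL2 Omega u -> `|coef u j| <= L2norm Omega u.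
Proof.
move=> Hu; rewrite -(@ler_pXn2r _ 2) ?nnegrE ?sqrtr_ge0// L2norm_sqr.
have := L2inner_ge0 (fun x => u x + (- coef u j) * phi j x).
rewrite L2inner_sq_lin// phi_orth eqxx mulr1 real_normK ?num_real//.
rewrite (_ : _ + _ + _ = L2inner Omega u u - coef u j ^+ 2); last by ring.
by rewrite subr_ge0.
Qed.

(** Coefficients are continuous in L^2, and those of the partial sums are stationary past index [j].
    Through this lemma the relations [Kop] and [regularized_solution] become equations between
    coefficients. *)
Lemma L2sum_coef c f j : L2sum Omega phi c f -> coef f j = c j.
Proof.
move=> [Hf cf]; apply/eqP; rewrite -subr_eq0 -normr_le0; apply/ler_addgt0Pl => e e0.
rewrite addr0.
have [n _ hn] : \forall n \near \oo, L2norm Omega (err c f n) < e.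
  have /cvgrPdist_lt/(_ e e0) := cf.
  apply: filterS => n; rewrite sub0r normrN ger0_norm ?sqrtr_ge0//.
have := coef_le_L2norm _ j (err_L2 c f (maxn n j.+1) Hf).
rewrite err_coef// leq_maxr distrC => /le_trans; apply.
by apply/ltW/hn; rewrite /= leq_maxl.
Qed.

(** By orthonormality the square norm of the truncation error is [L2inner Omega f f] minus the
    partial sum, and completeness sends it to 0. *)
Lemma Parseval_cvg f : inL2 Omega f ->
  \sum_(0 <= k < n) coef f k ^+ 2 @[n --> \oo] --> L2norm Omega f ^+ 2.
Proof.
move=> Hf; have [_ _ /(_ f Hf)[_ cf]] := phi_basis.
pose c k := coef f k.
have E n : L2inner Omega (err c f n) (err c f n) = L2inner Omega f f - \sum_(0 <= k < n) c k ^+ 2.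
  elim: n => [|n ih].
    rewrite err0 big_geq// subr0; apply: eq_Rintegral => x _; ring.
  rewrite errS L2inner_sq_lin//; last exact: err_L2.
  rewrite ih phi_orth eqxx mulr1 err_coef// ltnn big_nat_recr//= -/(c n); ring.
have h : L2norm Omega (err c f n) ^+ 2 @[n --> \oo] --> (0 : R).
  by rewrite -(mulr0 0); apply: (cvg_trans _ (cvgM cf cf)); apply: near_eq_cvg; apply: nearW => n; rewrite expr2.
have {}h : L2inner Omega f f - L2norm Omega (err c f n) ^+ 2 @[n --> \oo] --> L2inner Omega f f - 0.
  by apply: cvgB => //; exact: cvg_cst.
rewrite subr0 -L2norm_sqr in h; apply: cvg_trans h; apply: near_eq_cvg; apply: nearW => n.
by rewrite !L2norm_sqr E; ring.
Qed.

Lemma Parseval_le f n : inL2 Omega f -> \sum_(0 <= k < n) coef f k ^+ 2 <= L2norm Omega f ^+ 2.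
Proof.
move=> Hf; have h := Parseval_cvg _ Hf; rewrite -(cvg_lim _ h)//.
apply: nondecreasing_cvgn_le; last by apply/cvg_ex; eexists; exact: h.
by apply: nondecreasing_series => k _ _; exact: sqr_ge0.
Qed.

Lemma L2norm_le f B : inL2 Omega f -> 0 <= B ->
  (forall n, \sum_(0 <= k < n) coef f k ^+ 2 <= B ^+ 2) -> L2norm Omega f <= B.
Proof.
move=> Hf B0 hB; rewrite -(@ler_pXn2r _ 2) ?nnegrE ?sqrtr_ge0//.
by apply: (cvgr_to_le (Parseval_cvg _ Hf)); apply: nearW.
Qed.

End basis.
End L2_theory.

(** * Convergence rates for sequences *)

Section tikhonov_sequences.
Context {R : realType}.
Implicit Types (a b s x y : R) (u v : nat -> R).

(** Summed over coefficients, with [s] the ratio of the bounds for the two parts, this reproduces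
    the triangle inequality with its sharp constant; hence the weights [rho] and [rho - 1] below. *)
Lemma sqrD_le_weighted a b s : 0 < s -> (a + b) ^+ 2 <= (1 + s) * a ^+ 2 + (1 + s^-1) * b ^+ 2.
Proof.
move=> s0; rewrite -subr_ge0.
rewrite (_ : _ - _ = s^-1 * (s * a - b) ^+ 2); last by field; rewrite gt_eqF.
by rewrite mulr_ge0 ?sqr_ge0// invr_ge0 ltW.
Qed.

Lemma sum_le_lin n u v (z : nat -> R) a b : (forall k, u k <= a * v k + b * z k) ->
  \sum_(0 <= k < n) u k <= a * \sum_(0 <= k < n) v k + b * \sum_(0 <= k < n) z k.
Proof. by move=> h; rewrite !mulr_sumr -big_split; apply: ler_sum. Qed.

Lemma powR_mul_le_add x y a : 0 <= x -> 0 <= y -> 0 <= a <= 1 ->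
  x `^ a * y `^ (1 - a) <= x + y.
Proof.
move=> x0 y0 /andP[a0 a1]; pose m := Num.max x y.
have m0 : 0 <= m by rewrite le_max x0.
have mxy : m <= x + y by rewrite ge_max lerDl y0 lerDr x0.
apply: le_trans mxy; apply: (@le_trans _ _ (m `^ a * m `^ (1 - a))).
  apply: ler_pM; rewrite ?powR_ge0//; apply: ge0_ler_powR; rewrite ?subr_ge0 ?nnegrE//.
    by rewrite le_max lexx.
  by rewrite le_max lexx orbT.
(* Exponents add up for nonzero [m]; at 0 one of the two powers vanishes, although powR 0 0 is 1. *)
have [->|mn0] := eqVneq m 0; last first.
  by rewrite -powRD ?mn0 ?implybT// addrC subrK powRr1.
have [->|an0] := eqVneq a 0; first by rewrite powRr0 subr0 powRr1// mulr0.
by rewrite (powR0 an0) mul0r.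
Qed.

Lemma expR_powR x a : expR x `^ a = expR (a * x).
Proof. by rewrite /powR gt_eqF ?expR_gt0// expRK. Qed.

(** [T] is the spectral cutoff at which the bounds for high and low frequencies coincide: T^(-q) A =
    T B = X. *)
Lemma powR_balance (q A B : R) : 0 < q -> 0 < A -> 0 < B ->
  let T := (A / B) `^ (1 / (q + 1)) in
  let X := A `^ (1 / (q + 1)) * B `^ (q / (q + 1)) in
  T `^ (- (2 * q)) * A ^+ 2 = X ^+ 2 /\ T ^+ 2 * B ^+ 2 = X ^+ 2.
Proof.
move=> q0 A0 B0 /=.
have q10 : q + 1 != 0 by rewrite gt_eqF// addr_gt0.
(* In logarithmic variables an identity between products of powers becomes a linear identity between
   exponents. *)
move: (ln A) (ln B) (lnK A0) (lnK B0) => x y <- <-.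
rewrite -expRN -expRD !expR_powR -expRD -!expRM_natl -!expRD.
by split; congr expR; field.
Qed.

(** The frequencies are split at [T]: where [lam k >= T] the weighted bound [A] applies; below,
    [sig k] exceeds c/T and the bound [B] applies. *)
Lemma interpolation (lam sig v : nat -> R) (c q A B : R) :
  0 < c -> 0 < q -> 0 < A -> 0 < B -> (forall k, 0 < lam k) ->
  (forall k, c / lam k <= sig k) ->
  (forall n, \sum_(0 <= k < n) lam k `^ (2 * q) * v k ^+ 2 <= A ^+ 2) ->
  (forall n, \sum_(0 <= k < n) (sig k * v k) ^+ 2 <= B ^+ 2) ->
  forall n, \sum_(0 <= k < n) v k ^+ 2 <=
    ((1 + c^-1) * (A `^ (1 / (q + 1)) * B `^ (q / (q + 1)))) ^+ 2.
Proof.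
move=> c0 q0 A0 B0 lam0 hsig hA hB n.
have q10 : 0 < q + 1 by rewrite addr_gt0.
pose T := (A / B) `^ (1 / (q + 1)).
have AB0 : 0 < A / B by rewrite divr_gt0.
have T0 : 0 < T by rewrite powR_gt0.
have pt k : v k ^+ 2 <= T `^ (- (2 * q)) * (lam k `^ (2 * q) * v k ^+ 2) +
    (T / c) ^+ 2 * (sig k * v k) ^+ 2.
  have l0 := lam0 k.
  have [lT|lT] := leP T (lam k).
    rewrite -[leLHS]addr0 lerD//; last by rewrite mulr_ge0 ?sqr_ge0.
    rewrite mulrA ler_peMl ?sqr_ge0// powRN ler_pdivlMl ?powR_gt0// mulr1.
    by apply: ge0_ler_powR; rewrite ?nnegrE ?mulr_ge0 ?(ltW q0) ?(ltW T0) ?(ltW l0).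
  rewrite -[leLHS]add0r; apply: lerD.
    by apply: mulr_ge0; [exact: powR_ge0|apply: mulr_ge0; [exact: powR_ge0|exact: sqr_ge0]].
  rewrite (exprMn _ (sig k)) mulrA -exprMn ler_peMl ?sqr_ge0// exprn_ege1//.
  apply: (@le_trans _ _ (T / c * (c / lam k))); last by rewrite ler_pM2l// divr_gt0.
  by rewrite mulrA divfK ?gt_eqF// ler_pdivlMr// mul1r ltW.
have [AE BE] := powR_balance _ _ _ q0 A0 B0; rewrite -/T in AE BE.
have := sum_le_lin n _ _ _ _ _ pt.
move=> /le_trans; apply.
set X := A `^ _ * B `^ _ in AE BE *.
apply: (@le_trans _ _ (X ^+ 2 + c^-1 ^+ 2 * X ^+ 2)).
  apply: lerD.
    by rewrite -AE ler_pM2l ?powR_gt0.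
  rewrite -BE [leRHS]mulrA (_ : (T / c) ^+ 2 = c^-1 ^+ 2 * T ^+ 2); last by rewrite exprMn mulrC.
  apply: ler_wpM2l => //.
  by rewrite mulr_ge0 ?sqr_ge0.
have ci : 0 < c^-1 by rewrite invr_gt0.
rewrite [leRHS]exprMn -[X in X + _ <= _](mul1r (X ^+ 2)) -mulrDl ler_wpM2r ?sqr_ge0//.
by rewrite sqrrD expr1n mul1r lerD2r lerDl mulrn_wge0// ltW.
Qed.

Lemma sum_sqr_scale (u z v : nat -> R) a A n : (forall k, u k ^+ 2 <= a ^+ 2 * z k) ->
  \sum_(0 <= k < n) z k * v k ^+ 2 <= A ^+ 2 ->
  \sum_(0 <= k < n) (u k * v k) ^+ 2 <= (a * A) ^+ 2.
Proof.
move=> uz hA; rewrite [leRHS]exprMn.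
apply: (@le_trans _ _ (a ^+ 2 * \sum_(0 <= k < n) z k * v k ^+ 2)).
  by rewrite mulr_sumr; apply: ler_sum => k _; rewrite exprMn mulrA ler_wpM2r ?sqr_ge0.
by rewrite ler_wpM2l ?sqr_ge0.
Qed.

(** * Morozov's principle on coefficients: [g] source, [d] noisy data, [e] penalty weights *)

Section morozov.
Variables (lam sig e g d : nat -> R) (c tau delta rho : R).
Hypotheses (lam0_gt0 : 0 < lam 0) (lam0_le : forall k, lam 0 <= lam k).
Hypotheses (c_gt0 : 0 < c) (tau_gt0 : 0 < tau) (delta_gt0 : 0 < delta) (rho_gt1 : 1 < rho).
Hypothesis e_gt0 : forall k, 0 < e k.
Hypothesis sig_bounds : forall k, c / lam k <= sig k <= (lam k)^-1.

Let gt k := sig k / (sig k ^+ 2 + tau * e k) * d k.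
Let theta k := tau * e k / (sig k ^+ 2 + tau * e k).

Hypothesis noise_le : forall n, \sum_(0 <= k < n) (d k - sig k * g k) ^+ 2 <= delta ^+ 2.
Hypothesis discrepancy :
  \sum_(0 <= k < n) (sig k * gt k - d k) ^+ 2 @[n --> \oo] --> (rho * delta) ^+ 2.

Let lam_gt0 k : 0 < lam k. Proof. exact: lt_le_trans (lam0_le k). Qed.

Let sig_ge k : c / lam k <= sig k. Proof. by have /andP[] := sig_bounds k. Qed.

Let sig_gt0 k : 0 < sig k.
Proof. by apply: lt_le_trans (sig_ge k); rewrite divr_gt0. Qed.

Let te_gt0 k : 0 < tau * e k. Proof. exact: mulr_gt0. Qed.

Let den_gt0 k : 0 < sig k ^+ 2 + tau * e k.
Proof. by rewrite ltr_wpDl// sqr_ge0. Qed.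

Let theta_ge0 k : 0 <= theta k.
Proof. by rewrite divr_ge0// ltW. Qed.

Let theta_le1 k : theta k <= 1.
Proof. by rewrite ler_pdivrMr// mul1r lerDr sqr_ge0. Qed.

Let theta_sqr_le1 k : theta k ^+ 2 <= 1.
Proof. by rewrite expr_le1. Qed.

Let rho1_gt0 : 0 < rho - 1. Proof. by rewrite subr_gt0. Qed.

Let rho_gt0 : 0 < rho. Proof. exact: lt_trans rho_gt1. Qed.

Lemma discrepancy_le n : \sum_(0 <= k < n) (sig k * gt k - d k) ^+ 2 <= (rho * delta) ^+ 2.
Proof.
rewrite -(cvg_lim _ discrepancy)//; apply: nondecreasing_cvgn_le.
  by apply: nondecreasing_series => k _ _; exact: sqr_ge0.
by apply/cvg_ex; eexists; exact: discrepancy.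
Qed.

Lemma theta_data k : theta k * d k = d k - sig k * gt k.
Proof. by rewrite /theta /gt; field; rewrite gt_eqF. Qed.

Lemma regularization_error k :
  gt k - g k = sig k / (sig k ^+ 2 + tau * e k) * (d k - sig k * g k) - theta k * g k.
Proof. by rewrite /theta /gt; field; rewrite gt_eqF. Qed.

(** [theta k * d k] is the residual, so sig theta g is the residual minus the damped noise; the
    weight [rho] makes the two bounds add up exactly. *)
Lemma bias_residual n :
  \sum_(0 <= k < n) (sig k * (theta k * g k)) ^+ 2 <= ((1 + rho) * delta) ^+ 2.
Proof.
apply: (@le_trans _ _ ((1 + rho) * \sum_(0 <= k < n) (d k - sig k * g k) ^+ 2 +
    (1 + rho^-1) * \sum_(0 <= k < n) (sig k * gt k - d k) ^+ 2)).
  apply: sum_le_lin => k.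
  rewrite (_ : sig k * _ = - (theta k * (d k - sig k * g k)) + (d k - sig k * gt k)); last first.
    by rewrite -theta_data; ring.
  apply: (le_trans (sqrD_le_weighted _ _ _ rho_gt0)); rewrite sqrrN.
  rewrite (_ : (d k - sig k * gt k) ^+ 2 = (sig k * gt k - d k) ^+ 2); last by ring.
  apply: lerD => //; apply: ler_wpM2l; first by rewrite addr_ge0// ltW.
  by rewrite exprMn ler_piMl// sqr_ge0.
apply: (@le_trans _ _ ((1 + rho) * delta ^+ 2 + (1 + rho^-1) * (rho * delta) ^+ 2)).
  by apply: lerD; (apply: ler_wpM2l; first by rewrite addr_ge0 ?invr_ge0// ltW);
    [exact: noise_le|exact: discrepancy_le].
by rewrite le_eqVlt; apply/orP; left; apply/eqP; field; rewrite gt_eqF.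
Qed.

(** The reverse triangle inequality for the residual theta d, whose norm is rho delta while theta
    damps the noise to at most delta. The weight [rho - 1] is the one for which no constant is
    lost. *)
Lemma discrepancy_lower Q :
  (forall n, \sum_(0 <= k < n) (theta k * (sig k * g k)) ^+ 2 <= Q) ->
  ((rho - 1) * delta) ^+ 2 <= Q.
Proof.
move=> hQ.
have h : (rho * delta) ^+ 2 <= (1 + (rho - 1)) * delta ^+ 2 + (1 + (rho - 1)^-1) * Q.
  apply: (cvgr_to_le discrepancy); apply: nearW => n.
  apply: (@le_trans _ _ ((1 + (rho - 1)) * \sum_(0 <= k < n) (d k - sig k * g k) ^+ 2 +
      (1 + (rho - 1)^-1) * \sum_(0 <= k < n) (theta k * (sig k * g k)) ^+ 2)).
    apply: sum_le_lin => k.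
    rewrite -sqrrN opprB -theta_data.
    rewrite (_ : theta k * d k = theta k * (d k - sig k * g k) + theta k * (sig k * g k)); last by ring.
    apply: (le_trans (sqrD_le_weighted _ _ _ rho1_gt0)).
    apply: lerD => //; apply: ler_wpM2l; first by rewrite addr_ge0// ltW.
    by rewrite exprMn ler_piMl// sqr_ge0.
  apply: lerD; apply: ler_wpM2l => //.
    by rewrite addr_ge0// ltW.
  by rewrite addr_ge0// invr_ge0 ltW.
have r0 : rho / (rho - 1) * ((rho - 1) * delta) ^+ 2 <= rho / (rho - 1) * Q.
  have -> : rho / (rho - 1) * Q = (1 + (rho - 1)^-1) * Q.
    by field; rewrite gt_eqF.
  rewrite (_ : _ * _ ^+ 2 = (rho * delta) ^+ 2 - (1 + (rho - 1)) * delta ^+ 2).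
    by rewrite lerBlDl.
  by field; rewrite gt_eqF.
by move: r0; rewrite ler_pM2l// divr_gt0.
Qed.

(** For [e k >= 1] the squared filter is at most 1/tau, because tau e sig^2 <= (sig^2 + tau e)^2. *)
Lemma noise_le_tau : (forall k, 1 <= e k) -> forall n,
  \sum_(0 <= k < n) (sig k / (sig k ^+ 2 + tau * e k) * (d k - sig k * g k)) ^+ 2 <=
  delta ^+ 2 / tau.
Proof.
move=> e1 n; apply: (@le_trans _ _ (tau^-1 * \sum_(0 <= k < n) (d k - sig k * g k) ^+ 2)).
  rewrite mulr_sumr; apply: ler_sum => k _; rewrite exprMn; apply: ler_wpM2r; first exact: sqr_ge0.
  rewrite expr_div_n ler_pdivrMr ?exprn_gt0// ler_pdivlMl//.
  apply: (@le_trans _ _ (tau * e k * sig k ^+ 2)).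
    by rewrite ler_wpM2r ?sqr_ge0// ler_peMr// ltW.
  rewrite -subr_ge0 (_ : _ - _ = sig k ^+ 4 + (tau * e k) ^+ 2 + tau * e k * sig k ^+ 2); last by ring.
  have := te_gt0 k; have := sig_gt0 k => s0 t0.
  by rewrite !addr_ge0 ?exprn_ge0 ?mulr_ge0 ?exprn_ge0// ltW.
by rewrite mulrC ler_wpM2r ?invr_ge0 ?noise_le// ltW.
Qed.

(** With y = tau e, a weighted geometric mean of sig^2 and y bounds the denominator from below. Its
    weight (1 + q)/2 must not exceed 1, and this is where saturation at [q = 1] arises. *)
Lemma theta_sig_le (M q : R) k : e k <= M -> 0 < q <= 1 ->
  theta k * sig k <= c `^ (- q) * (tau * M) `^ ((1 + q) / 2) * lam k `^ q.
Proof.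
move=> eM /andP[q0 q1]; set y := tau * e k; set s := sig k.
have y0 : 0 < y by exact: te_gt0.
have s0 : 0 < s by exact: sig_gt0.
have h : s `^ (1 + q) * y `^ ((1 - q) / 2) <= s ^+ 2 + y.
  have := @powR_mul_le_add (s ^+ 2) y ((1 + q) / 2) (sqr_ge0 _) (ltW y0).
  rewrite -(powR_mulrn 2 (ltW s0)) -powRrM.
  rewrite (_ : 2 * ((1 + q) / 2) = 1 + q); last by field.
  rewrite (_ : 1 - (1 + q) / 2 = (1 - q) / 2); last by field.
  by apply; apply/andP; split; lra.
apply: (@le_trans _ _ (y `^ ((1 + q) / 2) * s `^ (- q))).
  rewrite /theta -/y -/s mulrAC ler_pdivrMr; last exact: den_gt0.
  apply: (@le_trans _ _ (y `^ ((1 + q) / 2) * s `^ (- q) * (s `^ (1 + q) * y `^ ((1 - q) / 2)))).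
    rewrite mulrACA [X in _ <= X](_ : _ =
      (y `^ ((1 + q) / 2) * y `^ ((1 - q) / 2)) * (s `^ (- q) * s `^ (1 + q))); last by ring.
    rewrite -!powRD ?(gt_eqF y0) ?(gt_eqF s0) ?implybT//.
    rewrite (_ : (1 + q) / 2 + (1 - q) / 2 = 1); last by field.
    by rewrite (_ : - q + (1 + q) = 1) ?powRr1 ?(ltW y0) ?(ltW s0)//; ring.
  by rewrite ler_wpM2l ?mulr_ge0 ?powR_ge0.
rewrite mulrAC [leRHS]mulrC; apply: ler_pM; rewrite ?powR_ge0//.
  apply: ge0_ler_powR; rewrite ?nnegrE ?(ltW y0)//.
  - by rewrite divr_ge0// addr_ge0// ltW.
  - by rewrite (le_trans (ltW y0))// ler_pM2l.
  - by rewrite ler_pM2l.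
rewrite !powRN [leRHS]mulrC ler_pdivlMr ?powR_gt0// mulrC ler_pdivrMr ?powR_gt0//.
rewrite -powRM ?(ltW s0) ?(ltW (lam_gt0 k))//.
apply: ge0_ler_powR; rewrite ?nnegrE ?(ltW q0) ?(ltW c_gt0) ?mulr_ge0 ?(ltW s0) ?(ltW (lam_gt0 k))//.
by rewrite mulrC -ler_pdivrMr.
Qed.

(** The discrepancy lower bound and [theta_sig_le] bound [tau] from below by a power of [delta],
    which is inserted into delta^2 / tau. *)
Lemma noise_rate (M q A : R) : (forall k, 1 <= e k <= M) -> 0 < q <= 1 -> 0 < A ->
  (forall n, \sum_(0 <= k < n) lam k `^ (2 * q) * g k ^+ 2 <= A ^+ 2) -> forall n,
  \sum_(0 <= k < n) (sig k / (sig k ^+ 2 + tau * e k) * (d k - sig k * g k)) ^+ 2 <=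
  ((1 + M) * (c `^ (- q)) `^ (1 / (q + 1)) *
    ((A / (rho - 1)) `^ (1 / (q + 1)) * delta `^ (q / (q + 1)))) ^+ 2.
Proof.
move=> eM q01 A0 hA n; have /andP[q0 q1] := q01.
have e1 k : 1 <= e k by have /andP[] := eM k.
have M0 : 0 < M by have /andP[/(lt_le_trans ltr01) h1 h2] := eM 0%N; exact: lt_le_trans h2.
apply: (le_trans (noise_le_tau e1 n)).
pose D := c `^ (- q); have D0 : 0 < D by rewrite powR_gt0.
pose T := (tau * M) `^ ((1 + q) / 2).
have tM0 : 0 < tau * M by exact: mulr_gt0.
have T0 : 0 < T by rewrite powR_gt0.
have le1 : (rho - 1) * delta <= D * T * A.
  rewrite -(@ler_pXn2r _ 2) ?nnegrE ?mulr_ge0 ?(ltW rho1_gt0) ?(ltW delta_gt0) ?(ltW D0) ?(ltW T0) ?(ltW A0)//.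
  apply: discrepancy_lower => m; rewrite -/(D * T).
  under eq_bigr do rewrite mulrA.
  apply: (@sum_sqr_scale _ (fun k => lam k `^ (2 * q))) => // k.
  rewrite (mulrC 2 q) powRrM powR_mulrn ?powR_ge0// -exprMn.
  apply: lerXn2r; rewrite ?nnegrE.
  - by rewrite mulr_ge0// ltW.
  - by rewrite !mulr_ge0 ?powR_ge0// ltW.
  - by apply: theta_sig_le => //; have /andP[] := eM k.
have le2 : ((rho - 1) * delta / (D * A)) `^ (2 / (1 + q)) <= tau * M.
  rewrite [leRHS](_ : _ = T `^ (2 / (1 + q))); last first.
    rewrite /T -powRrM (_ : (1 + q) / 2 * (2 / (1 + q)) = 1); first by rewrite powRr1// ltW.
    by field; rewrite gt_eqF// addr_gt0.
  apply: ge0_ler_powR; rewrite ?nnegrE.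
  - by rewrite divr_ge0// addr_ge0// ltW.
  - by rewrite !mulr_ge0 ?invr_ge0 ?mulr_ge0 ?(ltW rho1_gt0) ?(ltW delta_gt0) ?(ltW D0) ?(ltW A0).
  - exact: ltW.
  - by rewrite ler_pdivrMr ?mulr_gt0// mulrCA mulrA.
(* [Z] is determined by requiring that the lower bound for [tau * M], times Z^2, be exactly
   delta^2. *)
pose Z := D `^ (1 / (q + 1)) * ((A / (rho - 1)) `^ (1 / (q + 1)) * delta `^ (q / (q + 1))).
have dE : delta ^+ 2 = ((rho - 1) * delta / (D * A)) `^ (2 / (1 + q)) * Z ^+ 2.
  rewrite /Z; move: (ln A) (ln D) (ln (rho - 1)) (ln delta)
    (lnK A0) (lnK D0) (lnK rho1_gt0) (lnK delta_gt0) => a b x y <- <- <- <-.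
  rewrite -!expRD -!expRN -!expRD !expR_powR -!expRD -!expRM_natl -!expRD; congr expR; field.
  by rewrite addrC gt_eqF// addr_gt0.
rewrite -/D -mulrA -/Z ler_pdivrMr// dE.
apply: (@le_trans _ _ (tau * M * Z ^+ 2)); first by rewrite ler_wpM2r// sqr_ge0.
rewrite [leRHS]mulrC [X in _ <= _ * X]exprMn [leRHS]mulrA.
apply: ler_wpM2r; first exact: sqr_ge0.
apply: ler_wpM2l; first exact: ltW.
by have := sqr_ge0 M; have := M0; nra.
Qed.

Lemma bias_rate (q A : R) : 0 < q -> 0 < A ->
  (forall n, \sum_(0 <= k < n) lam k `^ (2 * q) * g k ^+ 2 <= A ^+ 2) -> forall n,
  \sum_(0 <= k < n) (theta k * g k) ^+ 2 <=
  ((1 + c^-1) * (A `^ (1 / (q + 1)) * ((1 + rho) * delta) `^ (q / (q + 1)))) ^+ 2.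
Proof.
move=> q0 A0 hA; apply: (@interpolation lam sig) => //.
- by rewrite mulr_gt0// addr_gt0.
- move=> n; apply: le_trans (hA n); apply: ler_sum => k _.
  by rewrite ler_wpM2l ?powR_ge0// exprMn ler_piMl// sqr_ge0.
- exact: bias_residual.
Qed.

Lemma error_le n X Y : 0 <= X -> 0 <= Y ->
  \sum_(0 <= k < n) (sig k / (sig k ^+ 2 + tau * e k) * (d k - sig k * g k)) ^+ 2 <= X ^+ 2 ->
  \sum_(0 <= k < n) (theta k * g k) ^+ 2 <= Y ^+ 2 ->
  \sum_(0 <= k < n) (gt k - g k) ^+ 2 <= (2 * (X + Y)) ^+ 2.
Proof.
move=> X0 Y0 hX hY.
apply: (@le_trans _ _ (2 * X ^+ 2 + 2 * Y ^+ 2)); last first.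
  rewrite -subr_ge0 (_ : _ - _ = 2 * (X ^+ 2 + Y ^+ 2 + 4 * (X * Y))); last by ring.
  by rewrite mulr_ge0// !addr_ge0 ?sqr_ge0// !mulr_ge0.
apply: le_trans (lerD (ler_wpM2l (ler0n _ 2) hX) (ler_wpM2l (ler0n _ 2) hY)).
apply: sum_le_lin => k; rewrite regularization_error.
apply: (le_trans (sqrD_le_weighted _ _ _ ltr01)).
by rewrite sqrrN invr1.
Qed.

Lemma rate_low (M q A : R) : (forall k, 1 <= e k <= M) -> 0 < q -> q <= 1 -> 0 < A ->
  (forall n, \sum_(0 <= k < n) lam k `^ (2 * q) * g k ^+ 2 <= A ^+ 2) -> forall n,
  \sum_(0 <= k < n) (gt k - g k) ^+ 2 <=
  (2 * ((1 + M) * (c `^ (- q)) `^ (1 / (q + 1)) *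
          ((A / (rho - 1)) `^ (1 / (q + 1)) * delta `^ (q / (q + 1))) +
        (1 + c^-1) * (A `^ (1 / (q + 1)) * ((1 + rho) * delta) `^ (q / (q + 1))))) ^+ 2.
Proof.
move=> eM q0 q1 A0 hA n.
have M0 : 0 < M by have /andP[/(lt_le_trans ltr01) h1 h2] := eM 0%N; exact: lt_le_trans h2.
apply: error_le.
- by rewrite !mulr_ge0 ?powR_ge0// addr_ge0// ltW.
- by rewrite !mulr_ge0 ?powR_ge0// addr_ge0// invr_ge0 ltW.
- by apply: noise_rate => //; rewrite q0.
- exact: bias_rate.
Qed.

(** Since theta <= 1 and sig <= 1/lam, the discrepancy lower bound limits [delta] itself; this
    disposes of surplus powers of [delta] when [p > 1]. *)
Lemma noise_level_le (q A : R) : 0 < q -> 0 < A ->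
  (forall n, \sum_(0 <= k < n) lam k `^ (2 * q) * g k ^+ 2 <= A ^+ 2) ->
  (rho - 1) * delta <= lam 0 `^ (- (1 + q)) * A.
Proof.
move=> q0 A0 hA.
rewrite -(@ler_pXn2r _ 2) ?nnegrE ?mulr_ge0 ?powR_ge0 ?(ltW rho1_gt0) ?(ltW delta_gt0) ?(ltW A0)//.
apply: discrepancy_lower => n; under eq_bigr do rewrite mulrA.
apply: (@sum_sqr_scale _ (fun k => lam k `^ (2 * q))) => // k.
rewrite (mulrC 2 q) powRrM powR_mulrn ?powR_ge0// -exprMn.
apply: lerXn2r; rewrite ?nnegrE.
- by rewrite mulr_ge0// ltW.
- by rewrite mulr_ge0 ?powR_ge0.
apply: (@le_trans _ _ (lam k)^-1).
  have /andP[_ sl] := sig_bounds k; apply: le_trans sl.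
  by rewrite ler_piMl// ltW.
apply: (@le_trans _ _ (lam k `^ (- (1 + q)) * lam k `^ q)); last first.
  apply: ler_wpM2r; first exact: powR_ge0.
  rewrite !powRN lef_pV2 ?posrE ?powR_gt0//.
  by apply: ge0_ler_powR; rewrite ?nnegrE ?addr_ge0 ?(ltW q0) ?(ltW lam0_gt0) ?(ltW (lam_gt0 k)).
rewrite -powRD ?(gt_eqF (lam_gt0 k)) ?implybT// (_ : - (1 + q) + q = - 1); last by ring.
by rewrite powR_inv1// ltW.
Qed.

(** The noise term can use the source condition only to order 1, whereas the bias is interpolated
    with the full order [p] and then weakened to delta^(1/2). *)
Lemma rate_high (M p A : R) : (forall k, 1 <= e k <= M) -> 1 <= p -> 0 < A ->
  (forall n, \sum_(0 <= k < n) lam k `^ (2 * p) * g k ^+ 2 <= A ^+ 2) -> forall n,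
  \sum_(0 <= k < n) (gt k - g k) ^+ 2 <=
  (2 * ((1 + M) * (c `^ (- 1)) `^ (1 / 2) * (lam 0 `^ (1 - p)) `^ (1 / 2) +
        (1 + c^-1) * (1 + rho) `^ (p / (p + 1)) * (rho - 1) `^ (1 / (p + 1)) *
          (lam 0 `^ (- (1 + p))) `^ ((p - 1) / (2 * (p + 1)))) *
    ((A / (rho - 1)) `^ (1 / 2) * delta `^ (1 / 2))) ^+ 2.
Proof.
move=> eM p1 A0 hA n; have p0 : 0 < p by exact: lt_le_trans p1.
have M0 : 0 < M by have /andP[/(lt_le_trans ltr01) h1 h2] := eM 0%N; exact: lt_le_trans h2.
have pp0 : 0 < p + 1 by rewrite addr_gt0.
have ci0 : 0 < c^-1 by rewrite invr_gt0.
(* The cost of weakening the source condition from order [p] to order 1 on a spectrum bounded below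
   by [lam 0]. *)
pose l0 := lam 0 `^ (1 - p); have l00 : 0 < l0 by rewrite powR_gt0.
have hA1 m : \sum_(0 <= k < m) lam k `^ (2 * 1) * g k ^+ 2 <= (l0 * A) ^+ 2.
  rewrite exprMn; apply: (@le_trans _ _ (l0 ^+ 2 * \sum_(0 <= k < m) lam k `^ (2 * p) * g k ^+ 2)).
    rewrite mulr_sumr; apply: ler_sum => k _; rewrite mulrA ler_wpM2r ?sqr_ge0//.
    rewrite (_ : 2 * 1 = - (2 * (p - 1)) + 2 * p); last by ring.
    rewrite powRD ?(gt_eqF (lam_gt0 k)) ?implybT//; apply: ler_wpM2r; first exact: powR_ge0.
    rewrite /l0 -powR_mulrn ?powR_ge0// -powRrM (_ : (1 - p) * 2 = - (2 * (p - 1))); last by ring.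
    rewrite !powRN lef_pV2 ?posrE ?powR_gt0//.
    by apply: ge0_ler_powR; rewrite ?nnegrE ?mulr_ge0 ?subr_ge0 ?(ltW lam0_gt0) ?(ltW (lam_gt0 k)).
  by rewrite ler_wpM2l ?sqr_ge0.
have lA0 : 0 < l0 * A by rewrite mulr_gt0.
have hN := @noise_rate M 1 (l0 * A) eM _ lA0 hA1 n.
have hB := @bias_rate p A p0 A0 hA n.
have dA := noise_level_le _ _ p0 A0 hA.
(* The surplus exponent p/(p + 1) - 1/2 of the bias. *)
pose al := (p - 1) / (2 * (p + 1)).
have al0 : 0 <= al by rewrite divr_ge0 ?subr_ge0// mulr_ge0// ltW.
pose S := (A / (rho - 1)) `^ (1 / 2) * delta `^ (1 / 2).
pose L := lam 0 `^ (- (1 + p)).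
have L0 : 0 < L by rewrite powR_gt0.
have rho10 : 0 < 1 + rho by rewrite addr_gt0.
have leB : A `^ (1 / (p + 1)) * ((1 + rho) * delta) `^ (p / (p + 1)) <=
    (1 + rho) `^ (p / (p + 1)) * (rho - 1) `^ (1 / (p + 1)) * L `^ al * S.
  rewrite powRM ?(ltW rho10) ?(ltW delta_gt0)//.
  rewrite (_ : p / (p + 1) = 1 / 2 + al); last by rewrite /al; field; rewrite gt_eqF.
  rewrite [delta `^ (_ + _)]powRD ?(gt_eqF delta_gt0) ?implybT//.
  have d_al : delta `^ al <= (L * A / (rho - 1)) `^ al.
    apply: ge0_ler_powR; rewrite ?nnegrE ?(ltW delta_gt0)//.
      by rewrite !mulr_ge0 ?invr_ge0 ?(ltW L0) ?(ltW A0) ?(ltW rho1_gt0).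
    by rewrite ler_pdivlMr// mulrC.
  apply: (@le_trans _ _ (A `^ (1 / (p + 1)) * ((1 + rho) `^ (1 / 2 + al) *
      (delta `^ (1 / 2) * (L * A / (rho - 1)) `^ al)))).
    by do 3 (apply: ler_wpM2l; first exact: powR_ge0).
  rewrite le_eqVlt; apply/orP; left; apply/eqP; rewrite /S /al.
  move: (ln A) (ln L) (ln (rho - 1)) (ln delta) (ln (1 + rho))
    (lnK A0) (lnK L0) (lnK rho1_gt0) (lnK delta_gt0) (lnK rho10) => a b x y z <- <- <- <- <-.
  rewrite -!expRN -!expRD !expR_powR -!expRD; congr expR; field.
  by rewrite gt_eqF.
pose Kn := (1 + M) * (c `^ (- 1)) `^ (1 / 2) * l0 `^ (1 / 2).
pose Kb := (1 + c^-1) * (1 + rho) `^ (p / (p + 1)) * (rho - 1) `^ (1 / (p + 1)) * L `^ al.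
have S0 : 0 <= S by rewrite mulr_ge0 ?powR_ge0.
have Kn0 : 0 <= Kn by rewrite !mulr_ge0 ?powR_ge0// addr_ge0// ltW.
have Kb0 : 0 <= Kb by rewrite !mulr_ge0 ?powR_ge0// addr_ge0// ltW.
rewrite -/l0 -/L -/al -/Kn -/Kb -/S (_ : 2 * (Kn + Kb) * S = 2 * (Kn * S + Kb * S)); last by ring.
apply: error_le; [exact: (mulr_ge0 Kn0 S0)|exact: (mulr_ge0 Kb0 S0)| |].
  apply: (le_trans (hN _)); first by rewrite ltr01 lexx.
  rewrite le_eqVlt; apply/orP; left; apply/eqP; congr (_ ^+ 2).
  rewrite (_ : 1 + 1 = 2) // -[l0 * A / _]mulrA (powRM _ (ltW l00)).
    by rewrite /Kn /S; ring.
  by rewrite divr_ge0// ltW.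
apply: (le_trans hB); apply: lerXn2r; rewrite ?nnegrE.
- by rewrite !mulr_ge0 ?powR_ge0// addr_ge0// ltW.
- exact: (mulr_ge0 Kb0 S0).
- have -> : Kb * S = (1 + c^-1) *
      ((1 + rho) `^ (p / (p + 1)) * (rho - 1) `^ (1 / (p + 1)) * L `^ al * S).
    by rewrite /Kb; ring.
  by apply: ler_wpM2l leB; rewrite addr_ge0// ltW.
Qed.

(** The Tikhonov functional splits over the coefficients and [gt k] minimizes each summand. As the
    residual of [gt] exceeds [delta], which bounds that of [g], the penalty of [gt] cannot exceed
    the bound for [g]. *)
Lemma minimizer_le (A : R) :
  (forall n, \sum_(0 <= k < n) e k * g k ^+ 2 <= A ^+ 2) ->
  forall n, \sum_(0 <= k < n) e k * gt k ^+ 2 <= A ^+ 2.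
Proof.
move=> hA n.
have pt k : (sig k * gt k - d k) ^+ 2 + tau * (e k * gt k ^+ 2) <=
    (d k - sig k * g k) ^+ 2 + tau * (e k * g k ^+ 2).
  rewrite -subr_ge0 [X in 0 <= X](_ : _ = (sig k ^+ 2 + tau * e k) * (g k - gt k) ^+ 2).
    by rewrite mulr_ge0 ?sqr_ge0// ltW.
  by rewrite /gt; field; rewrite gt_eqF.
(* The two truncations are decoupled: the residual passes to its limit in [m] while the penalty
   stays cut at [n]. *)
have h m : (n <= m)%N -> \sum_(0 <= k < m) (sig k * gt k - d k) ^+ 2 <=
    delta ^+ 2 + tau * A ^+ 2 - tau * \sum_(0 <= k < n) e k * gt k ^+ 2.
  move=> nm; rewrite lerBrDr.
  apply: (@le_trans _ _ (\sum_(0 <= k < m) ((sig k * gt k - d k) ^+ 2 + tau * (e k * gt k ^+ 2)))).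
    rewrite big_split/= lerD2l -mulr_sumr ler_pM2l// [leRHS](big_cat_nat _ (n := n))//= lerDl.
    by rewrite sumr_ge0// => k _; rewrite mulr_ge0 ?sqr_ge0// ltW.
  apply: (le_trans (ler_sum _ (fun k _ => pt k))).
  rewrite big_split/= -mulr_sumr; apply: lerD; first exact: noise_le.
  by rewrite ler_pM2l.
have : (rho * delta) ^+ 2 <= delta ^+ 2 + tau * A ^+ 2 - tau * \sum_(0 <= k < n) e k * gt k ^+ 2.
  by apply: (cvgr_to_le discrepancy); exists n.
have : delta ^+ 2 <= (rho * delta) ^+ 2.
  by apply: lerXn2r; rewrite ?nnegrE ?mulr_ge0 ?(ltW delta_gt0) ?(ltW rho_gt0)// ler_peMl// ltW.
move=> h1 h2; rewrite -(ler_pM2l tau_gt0) -subr_ge0; move: h1 h2.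
set X := tau * _; set Y := tau * _; lra.
Qed.

(** The error has penalty norm at most 2A and image norm at most (1 + rho) delta, so interpolation
    works for every positive [q], beyond the saturation level too. *)
Lemma rate_exp (q A D : R) : 0 < q -> 0 < A -> 0 < D ->
  (forall k, lam k `^ (2 * q) <= D ^+ 2 * e k) ->
  (forall n, \sum_(0 <= k < n) e k * g k ^+ 2 <= A ^+ 2) -> forall n,
  \sum_(0 <= k < n) (gt k - g k) ^+ 2 <=
  ((1 + c^-1) * ((D * (2 * A)) `^ (1 / (q + 1)) * ((1 + rho) * delta) `^ (q / (q + 1)))) ^+ 2.
Proof.
move=> q0 A0 D0 lD hA; apply: (@interpolation lam sig) => //.
- by rewrite !mulr_gt0.
- by rewrite mulr_gt0// addr_gt0.
- move=> n; rewrite exprMn.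
  apply: (@le_trans _ _ (D ^+ 2 * \sum_(0 <= k < n) e k * (gt k - g k) ^+ 2)).
    by rewrite mulr_sumr; apply: ler_sum => k _; rewrite mulrA ler_wpM2r ?sqr_ge0.
  rewrite ler_pM2l ?exprn_gt0//.
  apply: (@le_trans _ _ (2 * A ^+ 2 + 2 * A ^+ 2)); last by rewrite le_eqVlt; apply/orP; left; apply/eqP; ring.
  apply: le_trans (lerD (ler_wpM2l (ler0n _ 2) (minimizer_le _ hA n)) (ler_wpM2l (ler0n _ 2) (hA n))).
  apply: sum_le_lin => k.
  rewrite [leRHS](_ : _ = e k * ((1 + 1) * gt k ^+ 2 + (1 + 1) * g k ^+ 2)); last by ring.
  rewrite ler_pM2l//.
  by apply: (le_trans (sqrD_le_weighted _ _ _ ltr01)); rewrite sqrrN invr1.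
- move=> n; apply: (@le_trans _ _ ((1 + rho) * \sum_(0 <= k < n) (d k - sig k * g k) ^+ 2 +
    (1 + rho^-1) * \sum_(0 <= k < n) (sig k * gt k - d k) ^+ 2)).
    apply: sum_le_lin => k.
    rewrite (_ : sig k * _ = (d k - sig k * g k) + (sig k * gt k - d k)); last by ring.
    exact: sqrD_le_weighted.
  apply: (@le_trans _ _ ((1 + rho) * delta ^+ 2 + (1 + rho^-1) * (rho * delta) ^+ 2)).
    by apply: lerD; (apply: ler_wpM2l; first by rewrite addr_ge0 ?invr_ge0// ltW);
      [exact: noise_le|exact: discrepancy_le].
  by rewrite le_eqVlt; apply/orP; left; apply/eqP; field; rewrite gt_eqF.
Qed.

End morozov.
End tikhonov_sequences.

(** * Norm bounds, exponential weights and the final estimate *)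

Lemma nneseries_sqrt_le {R : realType} (u : nat -> R) (C : R) :
  (forall k, 0 <= u k) -> 0 <= C ->
  ((\sum_(0 <= k <oo) (u k)%:E) `^ 2^-1 <= C%:E)%E ->
  forall n, \sum_(0 <= k < n) u k <= C ^+ 2.
Proof.
move=> u0 C0 hC n.
have : ((\sum_(0 <= k < n) u k)%:E <= \sum_(0 <= k <oo) (u k)%:E)%E.
  by rewrite -sumEFin; apply: nneseries_lim_ge => k _ _; rewrite lee_fin.
move: hC; case: (\sum_(0 <= k <oo) (u k)%:E)%E => [s| |]//.
  rewrite poweR_EFin !lee_fin => sC ns; apply: (le_trans ns).
  have s0 : 0 <= s by apply: le_trans ns; exact: sumr_ge0.
  rewrite -(sqr_sqrtr s0) -powR12_sqrt//.
  by apply: lerXn2r; rewrite ?nnegrE ?powR_ge0.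
(* A divergent series is excluded: [+oo] to a nonzero power is [+oo], which no real bounds. *)
by rewrite /= invr_eq0 pnatr_eq0.
Qed.

Lemma powR_le_exp_powR {R : realType} (p r : R) : 0 < p -> 0 < r ->
  exists2 D : R, 0 < D & forall t, 0 < t -> t `^ p <= D ^+ 2 * expR (t `^ r).
Proof.
move=> p0 r0; have pr0 : 0 < p / r by rewrite divr_gt0.
(* Half the exponent p/r, since [D] enters squared. *)
exists ((2 * (p / r)) `^ (p / r / 2)); first by rewrite powR_gt0// mulr_gt0.
move=> t t0; have tr0 : 0 < t `^ r by rewrite powR_gt0.
rewrite -powR_mulrn ?powR_ge0// -powRrM divfK//.
have := powR_le_expR (p / r) (t `^ r) pr0 tr0.
rewrite -powRrM mulrCA divff ?gt_eqF// mulr1 => /le_trans; apply.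
by rewrite ler_wpM2l ?powR_ge0// ler_expR ler_piMr ?powR_ge0// invf_le1// ler1n.
Qed.

(** For [r <= 0] the power t^r is nonincreasing, so on the spectrum the weights lie between 1 and
    their value at [lambda 0]: the penalty is comparable to that of ordinary Tikhonov
    regularization. *)
Lemma exp_powR_bounds {R : realType} (a t r : R) : r <= 0 -> 0 < a -> a <= t ->
  1 <= expR (t `^ r) <= expR (a `^ r).
Proof.
move=> r0 a0 at_; rewrite -[X in X <= _]expR0 !ler_expR powR_ge0/=.
rewrite -[r]opprK !(powRN _ (- r)) lef_pV2 ?posrE ?powR_gt0//; last exact: lt_le_trans at_.
apply: ge0_ler_powR; rewrite ?oppr_ge0 ?nnegrE ?(ltW a0)//.
exact: le_trans (ltW a0) at_.
Qed.

Theorem theorem5 (R : realType) (N : nat) (N_ge1 : (1 <= N)%N)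
    (alpha beta l rho : R)
    (alpha_01 : 0 < alpha <= 1) (beta_ge0 : 0 <= beta) (l_gt0 : 0 < l)
    (rho_gt1 : 1 < rho)
    (Omega : set 'rV[R]_N) (Omega_dom : smooth_bounded_domain Omega)
    (L : ('rV[R]_N -> R) -> 'rV[R]_N -> R)
    (L_ell : symmetric_uniformly_elliptic Omega L)
    (lambda : nat -> R) (phi : nat -> 'rV[R]_N -> R)
    (L_eig : eigensystem Omega phi lambda L)
    (p r : R) (p_gt0 : 0 < p) :
  exists2 C : R, 0 < C &
  forall (delta tau : R) (g h hd gt Kgt : 'rV[R]_N -> R),
    0 < delta -> 0 < tau ->
    inL2 Omega g -> inL2 Omega hd ->
    Kop alpha beta l Omega lambda phi g h ->
    L2norm Omega (fun x => hd x - h x) <= delta ->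
    0 < rho * delta < L2norm Omega hd ->
    regularized_solution alpha beta l Omega lambda phi tau r hd gt ->
    Kop alpha beta l Omega lambda phi gt Kgt ->
    L2norm Omega (fun x => Kgt x - hd x) = rho * delta ->
    (r <= 0 -> forall C5 : R, 0 < C5 ->
      (Dnorm Omega phi lambda p g <= C5%:E)%E ->
      (1 <= p -> L2norm Omega (fun x => gt x - g x) <=
        C * ((C5 / (rho - 1)) `^ (1 / 2) +
             C5 `^ (1 / (p + 1)) * (1 + rho) `^ (p / (p + 1))) *
        delta `^ (1 / 2)) /\
      (p < 1 -> L2norm Omega (fun x => gt x - g x) <=
        C * ((C5 / (rho - 1)) `^ (1 / (p + 1)) +
             C5 `^ (1 / (p + 1)) * (1 + rho) `^ (p / (p + 1))) *
        delta `^ (p / (p + 1)))) /\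
    (0 < r -> forall C6 : R, 0 < C6 ->
      (expnorm Omega phi lambda r g <= C6%:E)%E ->
      L2norm Omega (fun x => gt x - g x) <=
        C * (2 * C6) `^ (2 / (p + 2)) * (1 + rho) `^ (p / (p + 2)) *
        delta `^ (p / (p + 2))).
Proof.
have [al0 al1] := andP alpha_01.
have [lam0 lamS _ basis _] := L_eig.
have lam_le k : lambda 0 <= lambda k.
  by elim: k => // k ih; exact: le_trans (lamS k).
have lamk k : 0 < lambda k by exact: lt_le_trans (lam_le k).
have [Oo _ _ _ _] := Omega_dom.
have phi2 k : inL2 Omega (phi k) by case: basis.
have [c c0 hc] := sigma_bounds alpha beta al0 al1 beta_ge0 l lambda l_gt0 lam0 lam_le.
have rho1 : 0 < rho - 1 by rewrite subr_gt0.
have rho0 : 0 < 1 + rho by rewrite addr_gt0// (lt_trans ltr01).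
have ci0 : 0 < c^-1 by rewrite invr_gt0.
pose M := expR (lambda 0 `^ r).
pose C1 := 2 * ((1 + M) * (c `^ (- 1)) `^ (1 / 2) * (lambda 0 `^ (1 - p)) `^ (1 / 2) +
  (1 + c^-1) * (1 + rho) `^ (p / (p + 1)) * (rho - 1) `^ (1 / (p + 1)) *
    (lambda 0 `^ (- (1 + p))) `^ ((p - 1) / (2 * (p + 1)))).
pose C2 := 2 * ((1 + M) * (c `^ (- p)) `^ (1 / (p + 1)) + (1 + c^-1)).
(* [D] has to be fixed with [C], before the sign of [r] is distinguished; for [r <= 0] it is the
   placeholder 1. *)
have [D D0 hD] : exists2 D : R, 0 < D &
    0 < r -> forall t, 0 < t -> t `^ p <= D ^+ 2 * expR (t `^ r).
  have [r0|r0] := ltP 0 r; last by exists 1.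
  by have [D D0 hD] := powR_le_exp_powR p r p_gt0 r0; exists D.
pose C3 := (1 + c^-1) * D `^ (2 / (p + 2)).
have M0 : 0 < M by exact: expR_gt0.
have C10 : 0 <= C1.
  by rewrite !mulr_ge0 ?powR_ge0// addr_ge0// !mulr_ge0 ?powR_ge0// addr_ge0// ltW.
have C20 : 0 < C2.
  by rewrite mulr_gt0// addr_gt0// ?mulr_gt0 ?powR_gt0// addr_gt0.
have C30 : 0 <= C3 by rewrite mulr_ge0 ?powR_ge0// addr_ge0// ltW.
exists (C1 + C2 + C3); first by rewrite ltr_pwDl// ltr_wpDl.
move=> delta tau g h hd gt Kgt delta0 tau0 Hg Hhd Kgh noise _ reg Kgt_ disc.
pose sig k := sigma alpha beta l lambda k.
pose e k := expR (lambda k `^ r).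
pose gk k := L2inner Omega g (phi k).
pose dk k := L2inner Omega hd (phi k).
pose gtk k := sig k / (sig k ^+ 2 + tau * e k) * dk k.
have Hgt : inL2 Omega gt by case: reg.
have Hh : inL2 Omega h by case: Kgh.
have HKgt : inL2 Omega Kgt by case: Kgt_.
have hE k : L2inner Omega h (phi k) = sig k * gk k by exact: (L2sum_coef _ Oo _ basis _ _ k Kgh).
have gtE k : L2inner Omega gt (phi k) = gtk k.
  exact: (L2sum_coef _ Oo _ basis _ _ k reg).
have KgtE k : L2inner Omega Kgt (phi k) = sig k * gtk k.
  by rewrite -gtE; exact: (L2sum_coef _ Oo _ basis _ _ k Kgt_).
have noise_le n : \sum_(0 <= k < n) (dk k - sig k * gk k) ^+ 2 <= delta ^+ 2.
  have H := inL2_sub _ Oo _ _ Hhd Hh.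
  apply: (@le_trans _ _ (L2norm Omega (fun x => hd x - h x) ^+ 2)); last first.
    by apply: lerXn2r; rewrite ?nnegrE ?sqrtr_ge0// ltW.
  apply: le_trans (Parseval_le _ Oo _ basis _ n H); apply: ler_sum => k _.
  by rewrite L2inner_subl// hE.
have discrepancy : \sum_(0 <= k < n) (sig k * gtk k - dk k) ^+ 2 @[n --> \oo] -->
    (rho * delta) ^+ 2.
  rewrite -disc; have H := inL2_sub _ Oo _ _ HKgt Hhd.
  apply: cvg_trans (Parseval_cvg _ Oo _ basis _ H); apply: near_eq_cvg; apply: nearW => n.
  by apply: eq_bigr => k _; rewrite L2inner_subl// KgtE.
have conclude B : 0 <= B -> (forall n, \sum_(0 <= k < n) (gtk k - gk k) ^+ 2 <= B ^+ 2) ->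
    L2norm Omega (fun x => gt x - g x) <= B.
  move=> B0 hB; apply: (L2norm_le _ Oo _ basis) => //; first exact: inL2_sub.
  move=> n; apply: le_trans (hB n); apply: ler_sum => k _.
  by rewrite L2inner_subl// gtE.
have CC1 : C1 <= C1 + C2 + C3 by rewrite -addrA lerDl addr_ge0// ltW.
have CC2 : C2 <= C1 + C2 + C3 by rewrite addrAC lerDr addr_ge0.
have CC3 : C3 <= C1 + C2 + C3 by rewrite lerDr addr_ge0// ltW.
have C0 : 0 <= C1 + C2 + C3 by rewrite !addr_ge0// ltW.
split=> [r0 C5 C50 gC5|r0 C6 C60 gC6].
  have hA : forall n, \sum_(0 <= k < n) lambda k `^ (2 * p) * gk k ^+ 2 <= C5 ^+ 2.
    apply: nneseries_sqrt_le => //; last exact: ltW.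
    by move=> k; rewrite mulr_ge0 ?powR_ge0 ?sqr_ge0.
  have eM k : 1 <= e k <= M by exact: exp_powR_bounds.
  split=> p1.
    have hr := @rate_high R lambda sig e gk dk c tau delta rho lam0 lam_le c0 tau0 delta0
      rho_gt1 (fun k => expR_gt0 _) hc noise_le discrepancy M p C5 eM p1 C50 hA.
    apply: (le_trans (conclude _ _ hr)).
      by rewrite -/C1 mulr_ge0// mulr_ge0 ?powR_ge0.
    rewrite -/C1 mulrA; apply: ler_wpM2r; first exact: powR_ge0.
    apply: ler_pM => //; first exact: powR_ge0.
    by rewrite lerDl mulr_ge0 ?powR_ge0.
  have hr := @rate_low R lambda sig e gk dk c tau delta rho lam0 lam_le c0 tau0 delta0
    rho_gt1 (fun k => expR_gt0 _) hc noise_le discrepancy M p C5 eM p_gt0 (ltW p1) C50 hA.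
  apply: (le_trans (conclude _ _ hr)).
    by rewrite mulr_ge0// addr_ge0// !mulr_ge0 ?powR_ge0// addr_ge0// ltW.
  rewrite (@powRM _ (1 + rho) delta _ (ltW rho0) (ltW delta0)).
  set X := (c `^ (- p)) `^ (1 / (p + 1)); set Y := (C5 / (rho - 1)) `^ (1 / (p + 1)).
  set Z := C5 `^ (1 / (p + 1)); set W := (1 + rho) `^ (p / (p + 1)); set d := delta `^ (p / (p + 1)).
  have Y0 : 0 <= Y by exact: powR_ge0.
  have ZW0 : 0 <= Z * W by rewrite mulr_ge0 ?powR_ge0.
  have d0 : 0 <= d by exact: powR_ge0.
  have X0 : 0 <= X by exact: powR_ge0.
  apply: (@le_trans _ _ (C2 * (Y + Z * W) * d)).
    rewrite -subr_ge0 [X in 0 <= X](_ : _ =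
      2 * (((1 + M) * X * (Z * W) + (1 + c^-1) * Y) * d)); last by rewrite /C2 -/X; ring.
    rewrite mulr_ge0// mulr_ge0// addr_ge0// mulr_ge0//; first rewrite mulr_ge0//.
      by rewrite addr_ge0// ltW.
    by rewrite addr_ge0// ltW.
  by apply: ler_wpM2r => //; apply: ler_wpM2r => //; exact: addr_ge0.
have hA : forall n, \sum_(0 <= k < n) e k * gk k ^+ 2 <= C6 ^+ 2.
  apply: nneseries_sqrt_le => //; last exact: ltW.
  by move=> k; rewrite mulr_ge0 ?expR_ge0 ?sqr_ge0.
(* Order p/2 turns the weight of the interpolation into lambda^p and its exponents into 2/(p + 2)
   and p/(p + 2). *)
have p20 : 0 < p / 2 by rewrite divr_gt0.
have hD' k : lambda k `^ (2 * (p / 2)) <= D ^+ 2 * e k.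
  by rewrite mulrC divfK//; exact: hD.
have hr := @rate_exp R lambda sig e gk dk c tau delta rho lam0 lam_le c0 tau0 delta0
  rho_gt1 (fun k => expR_gt0 _) hc noise_le discrepancy (p / 2) C6 D p20 C60 D0 hD' hA.
apply: (le_trans (conclude _ _ hr)).
  by rewrite mulr_ge0 ?mulr_ge0 ?powR_ge0// addr_ge0// ltW.
have q1 : 1 / (p / 2 + 1) = 2 / (p + 2).
  by field; rewrite !gt_eqF ?addr_gt0.
have q2 : p / 2 / (p / 2 + 1) = p / (p + 2).
  by field; rewrite !gt_eqF ?addr_gt0.
have C620 : 0 < 2 * C6 by rewrite mulr_gt0.
rewrite q1 q2 (@powRM _ D (2 * C6) _ (ltW D0) (ltW C620)).
rewrite (@powRM _ (1 + rho) delta _ (ltW rho0) (ltW delta0)).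
rewrite [leLHS](_ : _ = C3 * (2 * C6) `^ (2 / (p + 2)) * (1 + rho) `^ (p / (p + 2)) *
  delta `^ (p / (p + 2))); last by rewrite /C3; ring.
by do 3 (apply: ler_wpM2r; first exact: powR_ge0).
Qed.
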